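(* The bivariate $f$-polynomial $f^{TC}(x,y)=\sum_{n,k\ge0}f_{n,k}x^ky^n$ of the family of twisted cycle hypercube graph associahedra, where $f_{n,k}$ is the number of $k$-dimensional faces of the $n$-dimensional twisted cycle hypercube graph associahedron, is \[ f^{TC}(x,y)=\frac{(1-xy)-2y}{(1-xy)^2-4y}. \]
   Context: Let $\pm[n]=\{-n,\dots,-1,1,\dots,n\}$. The twisted cycle hypercube graph is the graph on $\pm[n]$ consisting of the cycle $(1,2,\dots,n,-1,-2,\dots,-n)$: consecutive vertices are adjacent, and $-n$ is adjacent to $1$ (for $n=1$ the pair $\{1,-1\}$ plays no role as an edge). A tube is a nonempty subset of $\pm[n]$ inducing a connected subgraph and containing no pair $\{i,-i\}$. Two tubes are weakly compatible if one is contained in the other, or they are disjoint with no edge between them. A tubing is a set of pairwise weakly compatible tubes whose union contains no pair $\{i,-i\}$. The $n$-dimensional twisted cycle hypercube graph associahedron is the simple $n$-dimensional polytope whose dual simplicial complex (sets of facets with nonempty intersection) is isomorphic to the complex of tubings, so its $k$-dimensional faces correspond to tubings with $n-k$ tubes; for $n=0$ it is a point. *)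

(* Defs.v *)
From HB Require Import structures.
From mathcomp Require Import all_boot all_order all_algebra.
From mathcomp Require Import finmap.
From mathcomp Require Import boolp classical_sets functions cardinality reals.

Set Implicit Arguments.
Unset Strict Implicit.
Unset Printing Implicit Defensive.

Import Order.TTheory GRing.Theory Num.Theory.
Local Open Scope classical_set_scope.
Local Open Scope ring_scope.

(* The vertices +-[n]: [(i, false)] is the vertex i + 1 and [(i, true)] is the *)
(* vertex -(i + 1).                                                            *)
Definition vertex (n : nat) : finType := ('I_n * bool)%type.

Definition vopp (n : nat) (v : vertex n) : vertex n := (v.1, ~~ v.2).

(* 0-based position in the cyclic word (1, ..., n, -1, ..., -n) *)
Definition cycle_pos (n : nat) (v : vertex n) : nat := (v.1 + v.2 * n)%N.

(* The condition [u.1 != v.1] only matters for n = 1, where it discards the    *)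
(* edge {1, -1}; for n >= 2 opposite vertices are never consecutive.           *)
Definition adj (n : nat) : rel (vertex n) := fun u v =>
  (u.1 != v.1) &&
  ((cycle_pos v == (cycle_pos u).+1 %[mod n.*2])%N ||
   (cycle_pos u == (cycle_pos v).+1 %[mod n.*2])%N).

Definition pair_free (n : nat) (A : {set vertex n}) : bool :=
  [forall v in A, vopp v \notin A].

Definition induces_connected (n : nat) (A : {set vertex n}) : bool :=
  [forall u in A, forall v in A,
     connect [rel a b | [&& a \in A, b \in A & adj a b]] u v].

Definition tube (n : nat) (A : {set vertex n}) : bool :=
  [&& A != finset.set0, induces_connected A & pair_free A].

Definition weakly_compatible (n : nat) (A B : {set vertex n}) : bool :=
  [|| A \subset B, B \subset A |
      [disjoint A & B] && [forall u in A, forall v in B, ~~ adj u v]].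

Definition tubing (n : nat) (S : {set {set vertex n}}) : bool :=
  [&& [forall A in S, tube A],
      [forall A in S, forall B in S, weakly_compatible A B] &
      pair_free (finset.cover S)].

Section Polytopes.
Context {R : realType} {m : nat}.
Implicit Types (P F : set 'rV[R]_m) (x : 'rV[R]_m).

(* A polytope is a bounded intersection of finitely many half-spaces. *)
Definition polytope P : Prop :=
  (exists (p : nat) (A : 'M[R]_(m, p)) (b : 'rV[R]_p),
     P = [set x | forall j, (x *m A) 0 j <= b 0 j]) /\
  (exists M : R, forall x, P x -> forall i, `|x 0 i| <= M).

(* [F] contains k + 1 affinely independent points, namely x0 and the x0 plus   *)
(* a row of D, and lies in their affine hull. The empty set has no dimension   *)
(* in this sense.                                                              *)
Definition has_dim F (k : nat) : Prop :=
  exists (x0 : 'rV[R]_m) (D : 'M[R]_(k, m)),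
    [/\ F x0, (forall i, F (x0 + row i D)), row_free D &
        forall x, F x -> (x - x0 <= D)%MS].

(* [P] itself and the empty set are faces. *)
Definition face P F : Prop :=
  exists (c : 'cV[R]_m) (d : R),
    (forall x, P x -> (x *m c) 0 0 <= d) /\
    F = [set x | P x /\ (x *m c) 0 0 = d].

Definition faces_of_dim P (k : nat) : set (set 'rV[R]_m) :=
  [set F | face P F /\ has_dim F k].

Definition facets P : set (set 'rV[R]_m) :=
  [set F | exists d, has_dim P d.+1 /\ faces_of_dim P d F].

Definition simple_polytope P : Prop :=
  polytope P /\
  forall n x, has_dim P n -> face P [set x] ->
    ([set F | facets P F /\ F x] #= `I_n)%card.

(* A set of facets is a simplex when its intersection is nonempty; the         *)
(* intersection of the empty set of facets is [P].                             *)
Definition dual_complex P : set (set (set 'rV[R]_m)) :=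
  [set S | S `<=` facets P /\ exists x, P x /\ forall F, S F -> F x].

(* [fset_set] is the empty set on infinite sets, but a polytope has finitely   *)
(* many faces.                                                                 *)
Definition nfaces P (k : nat) : nat := #|` fset_set (faces_of_dim P k)|%fset.

(* [phi] is an isomorphism from the complex of tubings, whose ground set is    *)
(* the set of tubes, to the dual complex, whose ground set is the set of       *)
(* facets.                                                                     *)
Definition twisted_cycle_associahedron (n : nat) P : Prop :=
  [/\ simple_polytope P, has_dim P n &
      exists phi : {set vertex n} -> set 'rV[R]_m,
        set_bij [set A | tube A] (facets P) phi /\
        forall S : {set {set vertex n}}, (forall A, A \in S -> tube A) ->
          (tubing S <-> dual_complex P (phi @` [set` S]))].

End Polytopes.

(* Formal power series in x and y with integer coefficients; [a n k] is the    *)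
(* coefficient of x^k y^n.                                                     *)
Definition bps : Type := nat -> nat -> int.

Definition bps_mul (a b : bps) : bps := fun n k =>
  \sum_(i < n.+1) \sum_(j < k.+1) a i j * b (n - i)%N (k - j)%N.

(* In {poly {poly int}} the outer variable is y and the inner one is x. *)
Definition px : {poly {poly int}} := 'X%:P.
Definition py : {poly {poly int}} := 'X.

Definition bps_of_poly (p : {poly {poly int}}) : bps := fun n k => p`_n`_k.

(* a = p / q in Z[[x, y]]: q has an inverse e there, and a = p e. *)
Definition bps_eq_frac (a : bps) (p q : {poly {poly int}}) : Prop :=
  exists e : bps,
    bps_mul (bps_of_poly q) e =2 bps_of_poly 1 /\
    a =2 bps_mul (bps_of_poly p) e.

Definition f_polynomial (R : realType) (m : nat -> nat)
    (P : forall n, set 'rV[R]_(m n)) : bps :=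
  fun n k => (nfaces (P n) k)%:Z.

(* Main.v *)
(* A simple polytope has, at each vertex, a simplicial cone of feasible           *)
(* directions, so its nonempty faces are exactly the intersections of the        *)
(* simplices of the dual complex, and a simplex of t facets spans a face of      *)
(* dimension n - t. The problem is thus to count tubings by number of tubes.     *)
(* Let b_l(z) enumerate the tubings of a path of l vertices that contain the     *)
(* whole path, and B(y) = sum_l b_l(z) y^l. Removing from a graph the maximal    *)
(* tube of a tubing at a given vertex, together with its neighbours and its      *)
(* opposites, leaves a smaller problem. On paths this gives, for Q = 1 + B, the  *)
(* equation Q + y Q = 1 + (1 + z) y Q^2; on the cycle, where a tube of l         *)
(* vertices covers a given vertex in l ways, it gives                            *)
(* F = 1 + y S + 2 (y B') K with K and S rational in B and y. The discriminant   *)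
(* (2 / Q - 1 - y)^2 = (1 - y)^2 - 4 y z then makes F rational:                  *)
(* F = (1 - y - 2 y z) / ((1 - y)^2 - 4 y z), and replacing y by x y and z by    *)
(* 1 / x gives the theorem.                                                      *)

Require Import Defs.
From HB Require Import structures.
From mathcomp Require Import all_boot all_order all_algebra.
From mathcomp Require Import ring lra zify.

Set Implicit Arguments.
Unset Strict Implicit.
Unset Printing Implicit Defensive.

Import Order.TTheory GRing.Theory Num.Theory.
Local Open Scope ring_scope.

(** * Tubings and their maximal tubes *)

(** The geometric half of the proof, [nfaces_tubings], turns faces of dimension k into tubings with
    n - k tubes. It rests on [simple_vertex_cone]: at a vertex of a simple polytope the constraints
    of the n facets through it are coordinates on the direction space. Hence facets with a common
    point meet in a face of the expected codimension that lies in no other facet ([simplex_face]),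
    and every nonempty face is the intersection of the facets containing it ([face_simplex]).

    The enumerative half rests on [tubing_poly_peel]. The tubes of a tubing through a fixed vertex
    form a chain; every other tube lies inside the largest one, X, or avoids X, its neighbours and
    its opposites. Tubes are arcs, so peeling the cycle leaves only arcs and pairs of antipodal
    strips. Their polynomials depend on the shape alone ([arc_shape], [tubing_poly_shape]), so the
    recurrences close up on a few families. Peeling the cycle at a vertex and at its opposite gives
    [cycle_rec], where the l + 1 positions of a tube of l + 1 vertices become a derivative of the
    series.

    As equations between power series, these recurrences express the cycle series through the
    quadratic series B and its derivative, and [cycle_series_eq] shows that the irrationality
    cancels. What remains is a linear recurrence of order two for [cycle_poly]; reversing
    coefficients gives [face_poly], which [face_poly_denom_inv] matches with the claimed
    fraction. *)

Definition ntubings (n t : nat) : nat :=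
  #|[set S : {set {set vertex n}} | tubing S & #|S| == t]|.

Section TubingPolynomial.
Context {n : nat}.
Implicit Types (A B X W : {set vertex n}) (S : {set {set vertex n}}).

Lemma voppK : involutive (@vopp n).
Proof. by case=> i s; rewrite /vopp /= negbK. Qed.

Lemma adj_sym : symmetric (@adj n).
Proof. by move=> u v; rewrite /adj eq_sym orbC. Qed.

Lemma pair_freeP A : reflect (forall v, v \in A -> vopp v \notin A) (pair_free A).
Proof. exact: forall_inP. Qed.

Lemma sub_pair_free A B : A \subset B -> pair_free B -> pair_free A.
Proof.
move=> /subsetP AB /pair_freeP Bf; apply/pair_freeP => v /AB/Bf.
exact: contra (AB _).
Qed.

Lemma tubingP S : reflect [/\ {in S, forall A, tube A},
    {in S &, forall A B, weakly_compatible A B} & pair_free (cover S)] (tubing S).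
Proof.
apply: (iffP and3P) => -[/forall_inP St Sc Sf]; split=> //.
  by move=> A B AS BS; have /forall_inP/(_ _ AS)/forall_inP/(_ _ BS) := Sc.
by apply/forall_inP => A AS; apply/forall_inP => B BS; apply: Sc.
Qed.

Lemma tubing_sub S S' : S' \subset S -> tubing S -> tubing S'.
Proof.
move=> /subsetP SS' /tubingP[St Sc Sf]; apply/tubingP; split.
- by move=> A /SS'/St.
- by move=> A B /SS' AS /SS' BS; apply: Sc.
- apply: sub_pair_free Sf; apply/bigcupsP => A /SS' AS.
  exact: bigcup_sup AS.
Qed.

Lemma tube_neq0 A : tube A -> A != set0.
Proof. by case/and3P. Qed.

Definition tubing_poly W : {poly int} :=
  \sum_(S | tubing S && (cover S \subset W)) 'X^#|S|.

Definition filled_poly X : {poly int} :=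
  \sum_(S | [&& tubing S, cover S \subset X & X \in S]) 'X^#|S|.

(* What remains available to the other tubes once X is a maximal tube. *)
Definition off W X : {set vertex n} :=
  [set u in W | [&& u \notin X, vopp u \notin X & [forall v in X, ~~ adj v u]]].

Lemma in_cover S v : reflect (exists2 A, A \in S & v \in A) (v \in cover S).
Proof. by apply: (iffP bigcupP) => -[A]; exists A. Qed.

Lemma tubing_poly0 : tubing_poly set0 = 1.
Proof.
rewrite /tubing_poly (big_pred1 set0) => [|S].
  by rewrite cards0 expr0.
apply/andP/eqP => [[/tubingP[St _ _] Sc]|->].
  apply/eqP; rewrite -subset0; apply/subsetP => A AS.
  have /tube_neq0/set0Pn[v vA] := St _ AS.
  have : v \in cover S by apply/in_cover; exists A.
  by move=> /(subsetP Sc); rewrite inE.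
rewrite /cover big_set0 subxx; split=> //; apply/tubingP; split.
- by move=> A; rewrite inE.
- by move=> A B; rewrite inE.
- by apply/pair_freeP => v; rewrite /cover big_set0 inE.
Qed.

(** A tubing inside X may gain or lose X freely, since X contains all its other tubes. So the
    tubings containing X weigh 'X times those that do not. *)
Lemma filled_poly_tubing X : tube X ->
  (1 + 'X) * filled_poly X = 'X * tubing_poly X.
Proof.
move=> tX; pose a : {poly int} :=
  \sum_(S | (tubing S && (cover S \subset X)) && (X \notin S)) 'X^#|S|.
have tE : tubing_poly X = filled_poly X + a.
  rewrite /tubing_poly (bigID (fun S => X \in S)) /=; congr (_ + _).
  by apply: eq_bigl => S; rewrite andbA.
suff bE : filled_poly X = 'X * a by rewrite tE bE; ring.
rewrite /filled_poly (reindex_onto (fun S => X |: S) (fun S => S :\ X)); last first.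
  by move=> S /and3P[_ _ XS]; rewrite setD1K.
rewrite /a big_distrr /=; apply: eq_big => S.
  rewrite setU11 andbT; apply/idP/idP.
    move=> /andP[/andP[St Sc] /eqP SE].
    have XS : X \notin S by rewrite -SE !inE eqxx.
    rewrite XS andbT (tubing_sub _ St) ?subsetUr //.
    apply: subset_trans Sc; apply/bigcupsP => A AS.
    by apply: (bigcup_sup A); rewrite // inE AS orbT.
  move=> /andP[/andP[/tubingP[St Sc Sf] Sx] XS].
  have cE : cover (X |: S) = X by rewrite /cover big_setU1 //=; apply/setUidPl.
  rewrite cE subxx andbT setU1K // eqxx andbT; apply/tubingP; split.
  - by move=> A; rewrite !inE => /predU1P[->|/St].
  - have sX A : A \in S -> A \subset X.
      by move=> AS; apply: subset_trans Sx; apply: bigcup_sup AS.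
    move=> A B; rewrite !inE => /predU1P[->|AS] /predU1P[->|BS].
    + by rewrite /weakly_compatible subxx.
    + by rewrite /weakly_compatible sX // orbT.
    + by rewrite /weakly_compatible sX.
    + exact: Sc.
  - by rewrite cE; case/and3P: tX.
move=> /andP[_ /eqP SE]; have XS : X \notin S by rewrite -SE !inE eqxx.
by rewrite cardsU1 XS exprD expr1.
Qed.

Section Peel.
Variable (v : vertex n).

Definition max_tube S := \bigcup_(A in S | v \in A) A.

(** Two tubes through v are not disjoint, so they are nested; one of maximal cardinality contains
    all the others. *)
Lemma max_tubeP S : tubing S -> v \in cover S ->
  [/\ max_tube S \in S, v \in max_tube S &
      forall A, A \in S -> v \in A -> A \subset max_tube S].
Proof.
move=> /tubingP[_ Sc _] /in_cover[A0 A0S vA0].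
have [X /andP[XS vX] Xmax] := @arg_maxnP _ A0
  (fun A => (A \in S) && (v \in A)) (fun A => #|A|) (introT andP (conj A0S vA0)).
have sX A : A \in S -> v \in A -> A \subset X.
  move=> AS vA; have /or3P[//|XA|/andP[/pred0P/(_ v)]] := Sc A X AS XS.
    by have := Xmax A; rewrite AS vA => /(_ isT) cA; rewrite (eqP (_ : X == A)) // eqEcard XA.
  by rewrite /= vA vX.
suff -> : max_tube S = X by [].
apply/eqP; rewrite eqEsubset; apply/andP; split.
  by apply/bigcupsP => A /andP[AS vA]; apply: sX.
by apply: (bigcup_sup X); rewrite XS.
Qed.

(** Either v is uncovered, or the tubing splits at its largest tube X through v into the tubes
    inside X and the rest. The conditions in [off] express weak compatibility with X together with
    the absence of opposite pairs, so any two such parts can be glued back. *)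
Lemma tubing_poly_peel W : v \in W ->
  tubing_poly W = tubing_poly (W :\ v) +
    \sum_(X | [&& tube X, v \in X & X \subset W]) filled_poly X * tubing_poly (off W X).
Proof.
move=> vW; rewrite {1}/tubing_poly (bigID (fun S => v \notin cover S)) /=.
congr (_ + _).
  by apply: eq_bigl => S; rewrite subsetD1 andbA.
rewrite (partition_big max_tube (fun X => [&& tube X, v \in X & X \subset W])); last first.
  move=> S /andP[/andP[St Sc]]; rewrite negbK => vS.
  have [XS vX _] := max_tubeP St vS; have /tubingP[St' _ _] := St.
  rewrite St' // vX; apply: subset_trans Sc; exact: bigcup_sup XS.
apply: eq_bigr => X /and3P[tX vX XW].
rewrite /filled_poly /tubing_poly big_distrlr /= pair_big /=.
pose h (SS : {set {set vertex n}} * {set {set vertex n}}) := SS.1 :|: SS.2.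
pose h' S := ([set A in S | A \subset X], [set A in S | ~~ (A \subset X)]).
rewrite (reindex_onto h h'); last first.
  by move=> S _; apply/setP => A; rewrite !inE -andb_orr orbN andbT.
have XP := tX; case/and3P: XP => _ _ /pair_freeP Xf.
apply: eq_big => [[S1 S2]|[S1 S2] /andP[_ /eqP[S1E S2E]]] /=; last first.
  rewrite /h /= -exprD cardsU disjoint_setI0 ?cards0 ?subn0 //.
  by rewrite -S1E -S2E; apply/pred0P => A /=; rewrite !inE; case: (A \subset X); rewrite ?andbF.
rewrite negbK /h /=; apply/idP/idP.
  move=> /andP[/andP[/andP[/andP[St Sc] vS] /eqP mX] /eqP[S1E S2E]].
  have [] := max_tubeP St vS; rewrite mX => XS _ Xmax.
  have /tubingP[_ Scomp /pair_freeP Sf] := St.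
  have XS1 : X \in S1 by rewrite -S1E inE XS subxx.
  have S1s : S1 \subset S1 :|: S2 by apply: subsetUl.
  have S2s : S2 \subset S1 :|: S2 by apply: subsetUr.
  rewrite (tubing_sub S1s St) (tubing_sub S2s St) XS1 andbT /=.
  apply/andP; split.
    by apply/bigcupsP => A; rewrite -S1E inE => /andP[].
  apply/bigcupsP => A AS2; apply/subsetP => u uA.
  have AS : A \in S1 :|: S2 by apply: (subsetP S2s).
  have uS : u \in cover (S1 :|: S2) by apply/in_cover; exists A.
  have nAX : ~~ (A \subset X) by move: AS2; rewrite -S2E inE => /andP[].
  have vA : v \notin A by apply: contra nAX; apply: Xmax.
  have /or3P[XA|AX|/andP[dXA /forall_inP nadj]] := Scomp X A XS AS.
  - by rewrite (subsetP XA) in vA.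
  - by rewrite AX in nAX.
  rewrite inE (subsetP Sc) //=; apply/and3P; split.
  - by apply: contraL dXA => uX; apply/pred0Pn; exists u; rewrite /= uX.
  - apply: contra (Sf u uS) => uX; apply/in_cover; by exists X.
  - by apply/forall_inP => w wX; have /forall_inP := nadj w wX; apply.
move=> /andP[/and3P[S1t S1c XS1] /andP[S2t S2c]].
have /tubingP[S1tube S1comp S1f] := S1t; have /tubingP[S2tube S2comp S2f] := S2t.
have s1 A : A \in S1 -> A \subset X.
  by move=> AS; apply: subset_trans S1c; apply: bigcup_sup AS.
have s2 A : A \in S2 -> A \subset off W X.
  by move=> AS; apply: subset_trans S2c; apply: bigcup_sup AS.
have ns2 A : A \in S2 -> ~~ (A \subset X).
  move=> AS; have /tube_neq0/set0Pn[u uA] := S2tube _ AS.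
  have := subsetP (s2 A AS) u uA; rewrite inE => /and4P[_ uX _ _].
  by apply: contra uX => /subsetP; apply.
have s12 A B : A \in S1 -> B \in S2 ->
    [disjoint A & B] && [forall a in A, forall b in B, ~~ adj a b].
  move=> AS BS; apply/andP; split.
    apply/pred0P => u /=; apply/negP => /andP[uA uB].
    have := subsetP (s2 B BS) u uB; rewrite inE => /and4P[_ /negP uX _ _].
    by apply: uX; apply: (subsetP (s1 A AS)).
  apply/forall_inP => a aA; apply/forall_inP => u uB.
  have := subsetP (s2 B BS) u uB; rewrite inE => /and4P[_ _ _ /forall_inP]; apply.
  exact: (subsetP (s1 A AS)).
have s21 A B : A \in S1 -> B \in S2 ->
    [disjoint B & A] && [forall b in B, forall a in A, ~~ adj b a].
  move=> AS BS; have /andP[dAB /forall_inP nadj] := s12 A B AS BS.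
  rewrite disjoint_sym dAB; apply/forall_inP => u uB; apply/forall_inP => a aA.
  by rewrite adj_sym; have /forall_inP := nadj a aA; apply.
have cE : cover (S1 :|: S2) = cover S1 :|: cover S2.
  by rewrite /cover bigcup_setU.
have St : tubing (S1 :|: S2).
  apply/tubingP; split.
  - by move=> A; rewrite inE => /orP[/S1tube|/S2tube].
  - move=> A B; rewrite !inE => /orP[AS|AS] /orP[BS|BS].
    + exact: S1comp.
    + by rewrite /weakly_compatible s12 // !orbT.
    + by rewrite /weakly_compatible s21 // !orbT.
    + exact: S2comp.
  rewrite cE; apply/pair_freeP => u; rewrite !inE negb_or => /orP[uS|uS].
    rewrite (pair_freeP _ S1f) //=; apply/negP => /(subsetP S2c).
    rewrite inE voppK => /and4P[_ _ /negP + _]; apply.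
    exact: (subsetP S1c).
  rewrite (pair_freeP _ S2f) // andbT; apply/negP => /(subsetP S1c).
  by have := subsetP S2c u uS; rewrite inE => /and4P[_ _ /negP].
have XS : X \in S1 :|: S2 by rewrite inE XS1.
have vS : v \in cover (S1 :|: S2) by apply/in_cover; exists X.
rewrite St vS cE andbT /=; apply/andP; split; [apply/andP; split|].
- rewrite subUset (subset_trans S1c XW) /=.
  by apply: subset_trans S2c _; apply/subsetP => u; rewrite inE => /andP[].
- have [mS vm mmax] := max_tubeP St vS.
  rewrite eqEsubset mmax // andbT.
  move: mS; rewrite inE => /orP[/s1//|/s2 /subsetP/(_ v vm)].
  by rewrite inE vX => /andP[].
- apply/eqP; congr pair; apply/setP => A; rewrite !inE.
    have [/s1 ->|/=] := boolP (A \in S1); first by [].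
    by have [/ns2/negbTE ->|] := boolP (A \in S2).
  have [AS1|/=] := boolP (A \in S1).
    rewrite s1 //=; apply/esym/negbTE/negP => /ns2.
    by rewrite s1.
  by have [/ns2 ->|] := boolP (A \in S2).
Qed.

End Peel.

Lemma coef_tubing_poly t : (tubing_poly [set: vertex n])`_t = (ntubings n t)%:Z.
Proof.
rewrite coef_sum -natz /ntubings -sum1_card natr_sum big_mkcond [RHS]big_mkcond /=.
apply: eq_bigr => S _; rewrite inE subsetT andbT coefXn eq_sym.
by case: (tubing S); case: eqP.
Qed.

End TubingPolynomial.

(** * Arcs of the cycle *)

(** Congruences between positions on the cycle become equalities once both indices lie in one window
    of a period, where [lia] decides them. *)
Lemma eqn_mod_window m p k l :
  (p <= k < p + m)%N -> (p <= l < p + m)%N -> (k == l %[mod m]) = (k == l).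
Proof.
wlog kl : k l / (k <= l)%N => [H hk hl|hk hl].
  by have [kl|/ltnW lk] := leqP k l; [exact: H|rewrite eq_sym H // eq_sym].
rewrite eq_sym eqn_mod_dvd //; apply/idP/eqP => [kl_m|->]; last by rewrite subnn dvdn0.
have [|l_k] := posnP (l - k); first lia.
have := dvdn_leq l_k kl_m; lia.
Qed.

Section Arcs.
Context {N : nat}.
Local Notation n := N.+1.
Implicit Types (u v : vertex n) (X : {set vertex n}).

(* The cyclic word of the vertices is indexed periodically by all naturals, so  *)
(* that the base point p of an arc can be chosen freely.                        *)
Definition vtx (k : nat) : vertex n :=
  (Ordinal (ltn_pmod k (ltn0Sn N)), odd (k %/ n)).

Lemma cycle_pos_vtx k : cycle_pos (vtx k) = (k %% n.*2)%N.
Proof.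
rewrite /cycle_pos /=; set r := (k %% n)%N; set q := (k %/ n)%N.
have kE : k = (q./2 * n.*2 + (r + odd q * n))%N.
  rewrite [LHS](divn_eq k n) -/q -/r -{1}(odd_double_half q).
  by case: (odd q); lia.
rewrite [in RHS]kE.
have rn : (r < n)%N by rewrite ltn_pmod.
by rewrite modnMDl modn_small //; case: (odd q); lia.
Qed.

Lemma cycle_pos_inj : injective (@cycle_pos n).
Proof.
move=> [i s] [j t]; rewrite /cycle_pos /= => ijst.
have /andP[/eqP ij /eqP st] : ((i == j :> nat) && (s == t)).
  by have := ltn_ord i; have := ltn_ord j; case: s t ijst => [] [] /=; lia.
by rewrite st; congr pair; apply: val_inj.
Qed.

Lemma vtx_eq k l : (vtx k == vtx l) = (k == l %[mod n.*2]).
Proof. by rewrite -(inj_eq cycle_pos_inj) !cycle_pos_vtx. Qed.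

Lemma vtx_cases p v : exists2 k, (k < n)%N & v = vtx (p + k) \/ v = vtx (p + n + k).
Proof.
pose c := cycle_pos v; pose j := ((c + (n.*2 - p %% n.*2)) %% n.*2)%N.
have n2 : (0 < n.*2)%N by [].
have jn : (j < n.*2)%N by rewrite ltn_pmod.
have cn : (c < n.*2)%N.
  by rewrite /c /cycle_pos; have := ltn_ord v.1; case: v.2; lia.
have vj : v = vtx (p + j).
  apply: cycle_pos_inj; rewrite cycle_pos_vtx -/c modnDmr -[LHS](modn_small cn).
  have pn := ltn_pmod p n2.
  rewrite {1}(divn_eq p n.*2) -addnA.
  have -> : (p %% n.*2 + (c + (n.*2 - p %% n.*2)) = n.*2 + c)%N by lia.
  by rewrite modnMDl modnDl.
have [jn'|nj] := ltnP j n; first by exists j => //; left.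
by exists (j - n)%N; [lia|right; rewrite vj; congr vtx; lia].
Qed.

Lemma vopp_vtx k : vopp (vtx k) = vtx (k + n).
Proof.
apply/eqP; rewrite /vopp /vtx /= xpair_eqE; apply/andP; split.
  by apply/eqP/val_inj; rewrite /= modnDr.
by rewrite divnDr ?dvdnn // divnn /= oddD addbT.
Qed.

Lemma vtx_period k : vtx (k + n.*2) = vtx k.
Proof. by apply/eqP; rewrite vtx_eq modnDr. Qed.

Lemma vopp_vtx' p k : vopp (vtx (p + n + k)) = vtx (p + k).
Proof. by rewrite vopp_vtx -(vtx_period (p + k)); congr vtx; lia. Qed.

Lemma vtx_same p j k : (j < n)%N -> (k < n)%N -> (vtx (p + j) == vtx (p + k)) = (j == k).
Proof. by move=> jn kn; rewrite vtx_eq (@eqn_mod_window _ p) ?eqn_add2l; lia. Qed.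

Lemma vtx_other p j k : (j < n)%N -> (k < n)%N -> vtx (p + j) == vtx (p + n + k) = false.
Proof.
by move=> jn kn; rewrite vtx_eq (@eqn_mod_window _ p); [apply/negbTE; lia|lia|lia].
Qed.

Lemma vtx_fst_eq k l : ((vtx k).1 == (vtx l).1) = (k == l %[mod n]).
Proof. by []. Qed.

Lemma adj_vtx k l : adj (vtx k) (vtx l) =
  (k != l %[mod n]) && ((l == k.+1 %[mod n.*2]) || (k == l.+1 %[mod n.*2])).
Proof.
by rewrite /adj vtx_fst_eq !cycle_pos_vtx !modn_mod -!(addn1 (_ %% _)) !modnDml !addn1.
Qed.

Lemma adj_same p j k : (j < n)%N -> (k < n)%N ->
  adj (vtx (p + j)) (vtx (p + k)) = (k == j.+1) || (j == k.+1).
Proof.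
move=> jn kn; rewrite adj_vtx -!addnS !(eqn_modDl p).
rewrite (@eqn_mod_window n 0) ?(@eqn_mod_window n.*2 0); lia.
Qed.

Lemma adj_other p j k : (j < n)%N -> (k < n)%N ->
  adj (vtx (p + j)) (vtx (p + n + k)) =
  (j != k) && ((j.+1 == n) && (k == 0%N) || (j == 0%N) && (k.+1 == n)).
Proof.
move=> jn kn; rewrite adj_vtx -!addnS -!addnA !(eqn_modDl p) modnDl.
rewrite (@eqn_mod_window n 0); [|lia|lia].
rewrite (@eqn_mod_window n.*2 0 (n + k)); [|lia|lia].
congr andb; congr orb; first lia.
have [E|] := eqVneq (n + k.+1)%N n.*2.
  by rewrite E modnn modn_small; lia.
move=> ?; rewrite (@eqn_mod_window n.*2 0); lia.
Qed.

End Arcs.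

Section Segments.
Context {N : nat}.
Local Notation n := N.+1.
Implicit Types (u v : vertex n) (X : {set vertex n}).

(* For k < n the vertex of index p + n + k is the opposite of that of index     *)
(* p + k, so the two clauses describe an arc and an arc of opposites.           *)
Definition seg (p a c b d : nat) : {set vertex n} :=
  [set v | [exists k : 'I_n, (v == vtx (p + k)) && (a <= k < c)%N ||
                             (v == vtx (p + n + k)) && (b <= k < d)%N]].

Lemma in_seg p a c b d k : (k < n)%N -> (vtx (p + k) \in seg p a c b d) = (a <= k < c)%N.
Proof.
move=> kn; rewrite inE; apply/existsP/idP => [[j]|kac].
  by rewrite vtx_same // vtx_other //= orbF => /andP[/eqP ->].
by exists (Ordinal kn); rewrite eqxx kac.
Qed.

Lemma in_seg_opp p a c b d k : (k < n)%N ->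
  (vtx (p + n + k) \in seg p a c b d) = (b <= k < d)%N.
Proof.
move=> kn; rewrite inE; apply/existsP/idP => [[j]|kac].
  by rewrite vtx_same // eq_sym vtx_other //= => /andP[/eqP ->].
by exists (Ordinal kn); rewrite eqxx kac orbT.
Qed.

Lemma vset_eq p (A B : {set vertex n}) :
  (forall k, (k < n)%N -> (vtx (p + k) \in A) = (vtx (p + k) \in B)) ->
  (forall k, (k < n)%N -> (vtx (p + n + k) \in A) = (vtx (p + n + k) \in B)) ->
  A = B.
Proof.
by move=> H H'; apply/setP => v; have [k kn [->|->]] := vtx_cases p v; auto.
Qed.

Lemma seg_tube p a c : (a < c)%N -> (c <= n)%N -> tube (seg p a c 0 0).
Proof.
move=> ac cn; have an : (a < n)%N by lia.
have av : vtx (p + a) \in seg p a c 0 0 by rewrite in_seg // leqnn.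
apply/and3P; split.
- by apply/set0Pn; exists (vtx (p + a)).
- rewrite /induces_connected; set e := rel_of_simpl _.
  have esym : symmetric e.
    move=> u v; rewrite /e /= adj_sym; by case: (u \in _); case: (v \in _).
  have ea k : (a <= k < c)%N -> connect e (vtx (p + a)) (vtx (p + k)).
    elim: k => [|k IH] kac; first by have -> : a = 0%N by lia.
    have [->//|ak] := eqVneq a k.+1.
    apply: connect_trans (IH _) (connect1 _); first lia.
    by rewrite /e /= !in_seg ?adj_same; lia.
  have eav v : v \in seg p a c 0 0 -> connect e (vtx (p + a)) v.
    have [k kn [->|->]] := vtx_cases p v; last by rewrite in_seg_opp.
    by rewrite in_seg //; apply: ea.
  apply/forall_inP => u uX; apply/forall_inP => v vX.
  apply: connect_trans (eav v vX).
  by rewrite (sym_connect_sym esym) eav.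
- apply/pair_freeP => v; have [k kn [->|->]] := vtx_cases p v.
    by rewrite vopp_vtx addnAC in_seg_opp.
  by rewrite in_seg_opp.
Qed.

Section PeelSegment.
Context (p a c b d : nat).
(** These conditions confine a tube through [vtx (p + a)] to the first strip. When a = 0, [ad] keeps
    out the predecessor of [vtx p], which is the last opposite. By [ab], an arc passing from the end
    of the first strip to [vtx (p + n)] would meet the opposite of its own first vertex; [ab] also
    makes the opposites left by a tube an interval. *)
Context (ac : (a < c)%N) (cn : (c <= n)%N) (dn : (d <= n)%N)
  (ab : (a <= b)%N || (d <= b)%N) (ad : (0 < a)%N || (d < n)%N).

Lemma tube_in_seg X : tube X -> vtx (p + a) \in X -> X \subset seg p a c b d ->
  exists2 l, (a <= l < c)%N & X = seg p a l.+1 0 0.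
Proof.
move=> /and3P[_ Xconn /pair_freeP Xf] aX /subsetP XW.
have an : (a < n)%N by lia.
pose stop e := (a < e)%N && ((e == c) || (vtx (p + e) \notin X)).
have ex_stop : exists e, stop e by exists c; rewrite /stop ac eqxx.
case: (ex_minnP ex_stop) => e /andP[ae estop] emin.
have ec : (e <= c)%N by apply: emin; rewrite /stop ac eqxx.
have eX k : (a <= k < e)%N -> vtx (p + k) \in X.
  move=> kae; have [<-//|ak] := eqVneq a k.
  have : ~~ stop k by apply/negP => /emin; lia.
  by rewrite /stop; case: (_ \in X) => //; rewrite orbT andbT; lia.
exists e.-1; first lia.
rewrite prednK; last lia.
apply/eqP; rewrite eqEsubset; apply/andP; split; last first.
  apply/subsetP => v; have [k kn [->|->]] := vtx_cases p v.
    by rewrite in_seg // => /eX.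
  by rewrite in_seg_opp.
apply/subsetP => v vX.
(* The initial run of X is closed under adjacency inside X, so it is all of X by connectedness. *)
have cl : closed [rel u w | [&& u \in X, w \in X & adj u w]] (mem (seg p a e 0 0)).
  apply: intro_closed.
    by apply: sym_connect_sym => u w /=; rewrite adj_sym; case: (u \in X); case: (w \in X).
  move=> u w /and3P[uX wX uw]; move: uX uw.
  have [j jn [->|->]] := vtx_cases p u; last by rewrite in_seg_opp.
  rewrite in_seg // => uX uw jae.
  move: wX uw; have [k kn [->|->]] := vtx_cases p w => wX; rewrite ?in_seg ?in_seg_opp //.
    have := XW _ wX; rewrite in_seg // adj_same // => kac /orP[/eqP kj|/eqP jk]; last lia.
    have [ke|] := eqVneq k e; last lia.
    by move: estop; rewrite -ke wX orbF => /eqP ?; lia.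
  have := XW _ wX; rewrite in_seg_opp // adj_other // => kbd.
  move=> /andP[_ /orP[/andP[/eqP jE /eqP kE]|/andP[/eqP jE /eqP kE]]]; last lia.
  have a0 : a = 0%N by lia.
  by have := Xf _ aX; rewrite a0 vopp_vtx addnAC -kE wX.
have /forall_inP/(_ _ aX)/forall_inP/(_ v vX) := Xconn.
move=> /(closed_connect cl) <-; rewrite in_seg //; lia.
Qed.

(** The tube occupies the indices a to l. Index l + 1 is lost as a neighbour, and the bound
    [maxn b l.+1] discards the opposites of the tube. *)
Lemma off_seg l : (a <= l < c)%N ->
  off (seg p a c b d) (seg p a l.+1 0 0) = seg p l.+2 c (maxn b l.+1) d.
Proof.
move=> lac; apply: (@vset_eq p) => k kn; rewrite [in LHS]inE.
  rewrite vopp_vtx addnAC !in_seg // in_seg_opp //=.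
  apply/idP/idP => [/and3P[kac kal /forall_inP nadj]|klc].
    suff : k != l.+1 by lia.
    apply/negP => /eqP kl; have ln : (l < n)%N by lia.
    have := nadj (vtx (p + l)); rewrite in_seg // adj_same // kl eqxx; lia.
  apply/and3P; split; [lia|lia|]; apply/forall_inP => v.
  have [j jn [->|->]] := vtx_cases p v; last by rewrite in_seg_opp.
  by rewrite in_seg // adj_same //; lia.
rewrite vopp_vtx' !in_seg_opp // !in_seg //=.
apply/idP/idP => [/and3P[kbd kal _]|kbd]; first lia.
apply/and3P; split; [lia|lia|]; apply/forall_inP => v.
have [j jn [->|->]] := vtx_cases p v; last by rewrite in_seg_opp.
rewrite in_seg // adj_other //; lia.
Qed.

Lemma seg_peel :
  tubing_poly (seg p a c b d) = tubing_poly (seg p a.+1 c b d) +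
    \sum_(a <= l < c) filled_poly (seg p a l.+1 0 0) *
                      tubing_poly (seg p l.+2 c (maxn b l.+1) d).
Proof.
have an : (a < n)%N by lia.
rewrite (@tubing_poly_peel _ (vtx (p + a))); last by rewrite in_seg // leqnn.
congr (_ + _).
  congr tubing_poly; apply: (@vset_eq p) => k kn.
    by rewrite in_setD1 vtx_same // !in_seg //; lia.
  by rewrite in_setD1 eq_sym vtx_other // !in_seg_opp.
pose arc (l : 'I_n) := seg p a l.+1 0 0.
have arc_inj : {in [set l : 'I_n | (a <= l < c)%N] &, injective arc}.
  move=> l l'; rewrite !inE => lac l'ac ll'; apply/val_inj => /=.
  have := in_seg p a l.+1 0 0 (ltn_ord l); have := in_seg p a l.+1 0 0 (ltn_ord l').
  rewrite -/(arc l) ll' !in_seg //; lia.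
rewrite (eq_bigl (mem (arc @: [set l : 'I_n | (a <= l < c)%N]))); last first.
  move=> X; apply/and3P/imsetP => [[tX aX XW]|[l]].
    have [l lac ->] := tube_in_seg tX aX XW; have ln : (l < n)%N by lia.
    by exists (Ordinal ln); rewrite ?inE.
  rewrite inE => lac ->; rewrite /arc; split; first by apply: seg_tube; lia.
    by rewrite in_seg //; lia.
  apply/subsetP => v; have [k kn [->|->]] := vtx_cases p v; last by rewrite in_seg_opp.
  by rewrite !in_seg //; lia.
pose F l := filled_poly (seg p a l.+1 0 0) * tubing_poly (seg p l.+2 c (maxn b l.+1) d).
rewrite big_imset //= -/(\sum_(a <= l < c) F l) big_geq_mkord.
rewrite (big_ord_widen_cond n (fun l => true && (a <= l)%N) F) //.
apply: eq_big => [l|l]; first by rewrite inE.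
by rewrite inE => lac; rewrite off_seg.
Qed.

End PeelSegment.
End Segments.

(** * Recurrences for tubing polynomials *)

Lemma filled_poly0 n : filled_poly (set0 : {set vertex n}) = 0.
Proof.
rewrite /filled_poly big1 // => S /and3P[/tubingP[St _ _] _ /St/tube_neq0].
by rewrite eqxx.
Qed.

Section SegmentShapes.
Context {N : nat}.
Local Notation n := N.+1.

Lemma seg_ext p a c b d a' c' b' d' :
  (forall k, (k < n)%N -> (a <= k < c)%N = (a' <= k < c')%N) ->
  (forall k, (k < n)%N -> (b <= k < d)%N = (b' <= k < d')%N) ->
  seg p a c b d = seg p a' c' b' d' :> {set vertex n}.
Proof.
move=> H H'; apply: (@vset_eq _ p) => k kn; first by rewrite !in_seg // H.
by rewrite !in_seg_opp // H'.
Qed.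

Lemma seg_empty p a c b d : (c <= a)%N -> (d <= b)%N ->
  seg p a c b d = set0 :> {set vertex n}.
Proof.
move=> ca db; apply: (@vset_eq _ p) => k kn; rewrite in_set0.
  by rewrite in_seg //; lia.
by rewrite in_seg_opp //; lia.
Qed.

Lemma seg_swap p a c b d :
  seg p a c b d = seg (p + n) b d a c :> {set vertex n}.
Proof.
apply: (@vset_eq _ p) => k kn; last by rewrite in_seg_opp // in_seg.
rewrite in_seg // -(vtx_period (p + k)).
have -> : (p + k + n.*2 = p + n + n + k)%N by lia.
by rewrite in_seg_opp.
Qed.

End SegmentShapes.

Definition arc_poly (l : nat) : {poly int} := tubing_poly (@seg l 0 0 l 0 0).

Definition tube_poly (l : nat) : {poly int} := filled_poly (@seg l 0 0 l 0 0).

(** The two equalities are proved together by strong induction, because peeling an arc involves both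
    polynomials of shorter arcs. *)
Lemma arc_shape_indep l N p a N' p' a' : (a + l <= N.+1)%N -> (a' + l <= N'.+1)%N ->
  tubing_poly (@seg N p a (a + l) 0 0) = tubing_poly (@seg N' p' a' (a' + l) 0 0) /\
  filled_poly (@seg N p a (a + l) 0 0) = filled_poly (@seg N' p' a' (a' + l) 0 0).
Proof.
have [k] := ubnP l; elim: k l N p a N' p' a' => // k IH [|l] N p a N' p' a' lk aN aN'.
  by rewrite !seg_empty ?tubing_poly0 ?filled_poly0 ?addn0.
(* All the terms of the peeling except the tube filling the whole arc. *)
pose rest M q e := tubing_poly (@seg M q e.+1 (e + l.+1) 0 0) +
  \sum_(0 <= i < l) filled_poly (@seg M q e (e + i.+1) 0 0) *
    tubing_poly (@seg M q (e + i.+2) (e + l.+1) 0 0).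
have restE M q e : (e + l.+1 <= M.+1)%N ->
    tubing_poly (@seg M q e (e + l.+1) 0 0) =
      rest M q e + filled_poly (@seg M q e (e + l.+1) 0 0) /\
    filled_poly (@seg M q e (e + l.+1) 0 0) = 'X * rest M q e.
  move=> eM; set f := filled_poly _; set t := tubing_poly _.
  have tE : t = rest M q e + f.
    rewrite /t seg_peel ?orbT //; last by lia.
    rewrite -addrA; congr (_ + _).
    rewrite -{1}[e]add0n -{1}[(e + l.+1)%N]addnC big_addn addnK big_nat_recr //=.
    congr (_ + _).
      rewrite !big_nat; apply: eq_bigr => i il.
      by congr (_ * _); [congr filled_poly|congr tubing_poly]; apply: seg_ext => j jn; lia.
    rewrite (@seg_empty _ q (l + e).+2) ?tubing_poly0 ?mulr1; [|lia|lia].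
    by congr filled_poly; apply: seg_ext => j jn; lia.
  (* Substituting t = rest + f here and cancelling the summand 'X f leaves f = 'X rest, without
     division by 1 + 'X. *)
  split=> //; have fE : (1 + 'X) * f = 'X * t.
    by apply/filled_poly_tubing/seg_tube => //; lia.
  rewrite {}tE in fE; apply: (addIr ('X * f)).
  by rewrite -mulrDr -fE mulrDl mul1r.
have [-> ->] := restE N p a aN; have [-> ->] := restE N' p' a' aN'.
suff -> : rest N p a = rest N' p' a' by [].
rewrite /rest; congr (_ + _).
  by rewrite -!addSnnS; apply: (IH l _ p a.+1 _ p' a'.+1 _ _ _).1; lia.
rewrite !big_nat; apply: eq_bigr => i il; congr (_ * _).
  by apply: (IH i.+1 _ p a _ p' a' _ _ _).2; lia.
have E e : (e + l.+1 = e + i.+2 + (l.+1 - i.+2))%N by lia.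
by rewrite !E; apply: (IH (l.+1 - i.+2)%N _ p _ _ p' _ _ _ _).1; lia.
Qed.

Lemma arc_shape l N p a : (a + l <= N.+1)%N ->
  tubing_poly (@seg N p a (a + l) 0 0) = arc_poly l /\
  filled_poly (@seg N p a (a + l) 0 0) = tube_poly l.
Proof. by move=> aN; apply: (@arc_shape_indep l N p a l 0 0 aN); lia. Qed.

(** The strips are placed from index 1 on in a cycle with one spare index, so the end of neither
    strip is adjacent to the start of the other. *)
Definition shape_poly (a c b d : nat) : {poly int} :=
  tubing_poly (@seg (maxn c d) 0 a.+1 c.+1 b.+1 d.+1).

Lemma tubing_poly_shape_indep N p e N' p' e' a c b d :
  (0 < e)%N -> (e + c <= N.+1)%N -> (e + d <= N.+1)%N ->
  (0 < e')%N -> (e' + c <= N'.+1)%N -> (e' + d <= N'.+1)%N ->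
  tubing_poly (@seg N p (e + a) (e + c) (e + b) (e + d)) =
  tubing_poly (@seg N' p' (e' + a) (e' + c) (e' + b) (e' + d)).
Proof.
move=> e0 ec ed e'0 e'c e'd.
have [k] := ubnP ((c - a) + (d - b)); elim: k => // k IH in p p' a c b d ec ed e'c e'd *.
move=> sk.
(* Peeling must act on the strip that starts no later than the other, or on the only nonempty one;
   [seg_swap] makes this the first strip. *)
wlog H : p p' a c b d ec ed e'c e'd sk /
    (a < c)%N && ((a <= b)%N || (d <= b)%N) || (c <= a)%N && (d <= b)%N => [W|].
  case: (boolP ((a < c)%N && ((a <= b)%N || (d <= b)%N) || (c <= a)%N && (d <= b)%N)) => H.
    exact: W.
  by rewrite seg_swap [in RHS]seg_swap; apply: W => //; lia.
have [/andP[ac ab]|/andP[ca db]] := orP H; last first.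
  by rewrite !seg_empty ?tubing_poly0 //; lia.
have peelE M q f : (0 < f)%N -> (f + c <= M.+1)%N -> (f + d <= M.+1)%N ->
   tubing_poly (@seg M q (f + a) (f + c) (f + b) (f + d)) =
   tubing_poly (@seg M q (f + a.+1) (f + c) (f + b) (f + d)) +
   \sum_(a <= l < c) tube_poly (l.+1 - a) *
     tubing_poly (@seg M q (f + l.+2) (f + c) (f + maxn b l.+1) (f + d)).
  move=> f0 fc fd; rewrite seg_peel; [|lia|lia|lia|lia|lia].
  rewrite addnS; congr (_ + _).
  rewrite ![(f + _)%N]addnC big_addn addnK !big_nat; apply: eq_bigr => l lac.
  congr (_ * _); last by congr tubing_poly; apply: seg_ext => j jM; lia.
  have -> : (l + f).+1 = (a + f + (l.+1 - a))%N by lia.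
  by apply: (arc_shape _ _).2; lia.
rewrite !peelE //; congr (_ + _); first by apply: IH => //; lia.
rewrite !big_nat; apply: eq_bigr => l lac; congr (_ * _).
by apply: IH => //; lia.
Qed.

Lemma tubing_poly_shape N p e a c b d :
  (0 < e)%N -> (e + c <= N.+1)%N -> (e + d <= N.+1)%N ->
  tubing_poly (@seg N p (e + a) (e + c) (e + b) (e + d)) = shape_poly a c b d.
Proof.
move=> e0 ec ed.
by apply: (@tubing_poly_shape_indep _ p e (maxn c d) 0 1 a c b d) => //; lia.
Qed.

Lemma shape_poly_swap a c b d : shape_poly a c b d = shape_poly b d a c.
Proof.
have cn : (1 + c <= (maxn c d).+1)%N by lia.
have dn : (1 + d <= (maxn c d).+1)%N by lia.
have <- := @tubing_poly_shape _ 0 1 a c b d isT cn dn.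
by rewrite seg_swap; apply: tubing_poly_shape.
Qed.

Lemma shape_poly_shift e a c b d :
  shape_poly (e + a) (e + c) (e + b) (e + d) = shape_poly a c b d.
Proof.
have cn : (e.+1 + c <= (maxn (e + c) (e + d)).+1)%N by lia.
have dn : (e.+1 + d <= (maxn (e + c) (e + d)).+1)%N by lia.
by rewrite -(@tubing_poly_shape _ 0 e.+1 a c b d isT cn dn) /shape_poly !addSn.
Qed.

Lemma shape_poly_ext a c b d a' c' b' d' :
  (forall k, (a <= k < c)%N = (a' <= k < c')%N) ->
  (forall k, (b <= k < d)%N = (b' <= k < d')%N) ->
  shape_poly a c b d = shape_poly a' c' b' d'.
Proof.
move=> H H'; pose M := maxn (maxn c d) (maxn c' d').
have cn : (1 + c <= M.+1)%N by lia.
have dn : (1 + d <= M.+1)%N by lia.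
have c'n : (1 + c' <= M.+1)%N by lia.
have d'n : (1 + d' <= M.+1)%N by lia.
have <- := @tubing_poly_shape _ 0 1 a c b d isT cn dn.
have <- := @tubing_poly_shape _ 0 1 a' c' b' d' isT c'n d'n.
congr tubing_poly; apply: seg_ext => -[|k] _ //; first exact: H.
exact: H'.
Qed.

Lemma shape_poly_empty a c b d : (c <= a)%N -> (d <= b)%N -> shape_poly a c b d = 1.
Proof. by move=> ca db; rewrite /shape_poly seg_empty ?tubing_poly0. Qed.

Lemma shape_poly_peel a c b d : (a < c)%N -> (a <= b)%N || (d <= b)%N ->
  shape_poly a c b d = shape_poly a.+1 c b d +
    \sum_(a <= l < c) tube_poly (l.+1 - a) * shape_poly l.+2 c (maxn b l.+1) d.
Proof.
move=> ac ab; rewrite {1}/shape_poly seg_peel; [|lia|lia|lia|lia|lia].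
congr (_ + _); rewrite big_add1 /= !big_nat; apply: eq_bigr => l lac; congr (_ * _).
  have -> : l.+2 = (a.+1 + (l.+1 - a))%N by lia.
  by apply: (arc_shape _ _).2; lia.
by rewrite maxnSS; apply: (@tubing_poly_shape _ _ 1); lia.
Qed.

(** A tube of i + 1 vertices at the start also costs its next vertex, leaving l - i - 1 vertices;
    when l = i nothing is left and the factor is 1. *)
Lemma arc_poly_rec l : arc_poly l.+1 = arc_poly l +
  \sum_(i < l.+1) tube_poly i.+1 * (if (l - i)%N is j.+1 then arc_poly j else 1).
Proof.
rewrite /arc_poly seg_peel // big_mkord; congr (_ + _).
  by rewrite -/(arc_poly l); apply: (@arc_shape l l.+1 0 1 _).1.
apply: eq_bigr => i _; have il := ltn_ord i; congr (_ * _).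
  by apply: (@arc_shape i.+1 l.+1 0 0 _).2; lia.
case E : (l - i)%N => [|j]; first by rewrite seg_empty ?tubing_poly0 //; lia.
rewrite -/(arc_poly j) -(@arc_shape j l.+1 0 i.+2 _).1; last by lia.
by congr tubing_poly; apply: seg_ext => k kn; lia.
Qed.

Lemma tube_poly_arc l : (0 < l)%N -> (1 + 'X) * tube_poly l = 'X * arc_poly l.
Proof. by move=> l0; apply/filled_poly_tubing/seg_tube. Qed.

Lemma tube_poly0 : tube_poly 0 = 0.
Proof. by rewrite /tube_poly seg_empty ?filled_poly0. Qed.

(* Two antipodal strips of m vertices each: all of them (strip2), with one      *)
(* strip losing its first vertex (strip1), one losing its last vertex (open1),  *)
(* or one losing the first and the other (open_ne) or the same one (open_eq)    *)
(* losing the last vertex.                                                      *)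
Definition strip2 m := shape_poly 0 m 0 m.
Definition strip1 m := shape_poly 1 m 0 m.
Definition open1 m := shape_poly 0 m 0 m.-1.
Definition open_ne m := shape_poly 1 m 0 m.-1.
Definition open_eq m : {poly int} := if m is m'.+1 then shape_poly 0 m'.+1 1 m' else 0.

Lemma shape_poly_peel0 m b d : (0 < m)%N ->
  shape_poly 0 m b d = shape_poly 1 m b d +
    \sum_(l < m) tube_poly l.+1 * shape_poly l.+2 m (maxn b l.+1) d.
Proof.
by move=> m0; rewrite shape_poly_peel // big_mkord; under eq_bigr do rewrite subn0.
Qed.

(** A tube of l + 1 vertices at the start removes its opposites and its next vertex, leaving two
    strips of m - l - 1 with one first vertex missing. The other strip recurrences arise in the same
    way, after exchanging the strips where needed. *)
Lemma strip2_rec m :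
  strip2 m = strip1 m + \sum_(l < m) tube_poly l.+1 * strip1 (m - l.+1).
Proof.
case: m => [|m]; first by rewrite /strip2 /strip1 !shape_poly_empty // big_ord0 addr0.
rewrite /strip2 shape_poly_peel0 //; congr (_ + _); apply: eq_bigr => l _.
have lm := ltn_ord l; congr (_ * _); rewrite -[RHS](shape_poly_shift l.+1).
by apply: shape_poly_ext => k; lia.
Qed.

Lemma strip1_rec m : strip1 m.+1 =
  strip2 m + \sum_(l < m.+1) tube_poly l.+1 * strip1 (m.+1 - l.+1).
Proof.
rewrite /strip1 shape_poly_swap shape_poly_peel0 //; congr (_ + _).
  exact: (shape_poly_shift 1 0 m 0 m).
apply: eq_bigr => l _; have lm := ltn_ord l; congr (_ * _).
by rewrite -[RHS](shape_poly_shift l.+1); apply: shape_poly_ext => k; lia.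
Qed.

Lemma strip1_0 : strip1 0 = 1.
Proof. exact: shape_poly_empty. Qed.

Lemma open1_rec m :
  open1 m = open_ne m + \sum_(l < m) tube_poly l.+1 * open_ne (m - l.+1).
Proof.
case: m => [|m]; first by rewrite /open1 /open_ne !shape_poly_empty // big_ord0 addr0.
rewrite /open1 shape_poly_peel0 //; congr (_ + _); apply: eq_bigr => l _.
have lm := ltn_ord l; congr (_ * _); rewrite -[RHS](shape_poly_shift l.+1).
by apply: shape_poly_ext => k; lia.
Qed.

Lemma open_ne0 : open_ne 0 = 1.
Proof. exact: shape_poly_empty. Qed.

Lemma open_ne_rec m : open_ne m.+1 =
  open1 m + \sum_(l < m.+1) tube_poly l.+1 * open_eq (m.+1 - l.+1).
Proof.
(* The peeled strip has only m vertices. The conventional value [open_eq 0] = 0 annihilates the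
   extra summand, which makes the sum a full convolution. *)
rewrite big_ord_recr /= subnn mulr0 addr0.
rewrite /open_ne shape_poly_swap; case: m => [|m].
  by rewrite /open1 big_ord0 addr0 !shape_poly_empty.
rewrite shape_poly_peel0 //; congr (_ + _).
  rewrite shape_poly_swap /open1 -[RHS](shape_poly_shift 1).
  by apply: shape_poly_ext => k; lia.
apply: eq_bigr => l _; have lm := ltn_ord l; congr (_ * _).
have -> : (m.+2 - l.+1 = (m - l).+1)%N by lia.
rewrite shape_poly_swap /open_eq -[RHS](shape_poly_shift l.+1).
by apply: shape_poly_ext => k; lia.
Qed.

Lemma open_eq_rec m : open_eq m.+1 =
  open1 m + \sum_(l < m.+1) tube_poly l.+1 * open_ne (m.+1 - l.+1).
Proof.
rewrite /open_eq shape_poly_peel0 //; congr (_ + _).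
  rewrite /open1 -[RHS](shape_poly_shift 1).
  by apply: shape_poly_ext => k; lia.
apply: eq_bigr => l _; have lm := ltn_ord l; congr (_ * _).
rewrite /open_ne -[RHS](shape_poly_shift l.+1).
by apply: shape_poly_ext => k; lia.
Qed.

(** * Peeling the whole cycle *)

Section WholeCycle.
Context {N : nat}.
Local Notation n := N.+1.

Lemma tube_arc (X : {set vertex n}) q : tube X -> vtx q \in X ->
  exists i l, [/\ (i <= l)%N, (l < n)%N & X = seg (q + n.*2 - i) 0 l.+1 0 0].
Proof.
move=> tX qX; have /and3P[_ _ /pair_freeP Xf] := tX.
(* Walk backwards from q to the start of the arc. The walk ends within N steps, since the opposite
   of [vtx q] is not in X; the summand [n.*2] avoids truncated subtraction. *)
pose stop i := vtx (q + n.*2 - i.+1) \notin X.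
have stopN : stop N.
  have := Xf _ qX; rewrite vopp_vtx /stop; have -> // : (q + n.*2 - n = q + n)%N by lia.
have ex_stop : exists i, stop i by exists N.
case: (ex_minnP ex_stop) => i istop imin.
have iN : (i <= N)%N by apply: imin.
pose p := (q + n.*2 - i)%N.
have pX : vtx (p + 0) \in X.
  rewrite addn0; case: i => [|i] in istop imin iN @p *.
    by rewrite /p subn0 vtx_period.
  by apply: contraT => /imin; rewrite ltnn.
(* The predecessor of [vtx p] is the last opposite and is not in X, so the second strip may stop at
   N, as [tube_in_seg] requires. *)
have [||||||l lN XE] := @tube_in_seg N p 0 n 0 N _ _ _ _ _ X tX pX; try lia.
  apply/subsetP => v; have [k kn [->|->]] := vtx_cases p v.
    by rewrite in_seg // => _; lia.
  rewrite in_seg_opp // => kX; suff : k != N by lia.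
  apply: contraNneq istop => kN; rewrite -(vtx_period (_ - _)).
  by move: kX; rewrite kN; congr (vtx _ \in X); rewrite /p; lia.
exists i, l; split; [|lia|exact: XE].
have : vtx (p + i) \in X.
  by rewrite -(vtx_period q) in qX; move: qX; congr (vtx _ \in X); rewrite /p; lia.
by rewrite XE in_seg //; lia.
Qed.

Lemma arc_mem q i l : (i <= l)%N -> (l < n)%N ->
  vtx q \in @seg N (q + n.*2 - i) 0 l.+1 0 0.
Proof.
move=> il ln; set p := (_ - i)%N; have pE : (q + n.*2 = p + i)%N by lia.
by rewrite -(vtx_period q) pE in_seg //; lia.
Qed.

Lemma arc_inj q i l i' l' : (i <= l < n)%N -> (i' <= l' < n)%N ->
  @seg N (q + n.*2 - i) 0 l.+1 0 0 = @seg N (q + n.*2 - i') 0 l'.+1 0 0 ->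
  i = i' /\ l = l'.
Proof.
wlog ii' : i l i' l' / (i <= i')%N => [H hi hi' E|il il' E].
  have [ii'|/ltnW i'i] := leqP i i'; first exact: H.
  by have [] := H _ _ _ _ i'i hi' hi (esym E).
have ii : i = i'.
  apply/eqP; rewrite eqn_leq ii' leqNgt; apply/negP => lt_ii'.
  have : vtx (q + n.*2 - i' + (i' - i.+1)) \in @seg N (q + n.*2 - i') 0 l'.+1 0 0.
    by rewrite in_seg; lia.
  rewrite -E -vtx_period.
  have -> : (q + n.*2 - i' + (i' - i.+1) + n.*2 = q + n.*2 - i + n + N)%N by lia.
  by rewrite in_seg_opp.
split=> //; move: E; rewrite -ii => E.
have := @in_seg N (q + n.*2 - i) 0 l.+1 0 0 l _.
have := @in_seg N (q + n.*2 - i) 0 l.+1 0 0 l' _.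
rewrite E !in_seg //; lia.
Qed.

(** The only vertex that W may lack is opposite to a vertex of the arc, hence discarded anyway. The
    arc has a neighbour at each end: index l + 1 and the last opposite. *)
Lemma off_arc (W : {set vertex n}) p q l : (l < n)%N ->
  (forall u, u != vopp (vtx q) -> u \in W) -> vtx q \in @seg N p 0 l.+1 0 0 ->
  off W (seg p 0 l.+1 0 0) = seg p l.+2 n l.+1 N.
Proof.
move=> ln Wu qX.
have offE u : vopp u \notin seg p 0 l.+1 0 0 -> u \in W.
  move=> uX; apply: Wu; apply: contraNneq uX => ->; by rewrite voppK.
apply: (@vset_eq _ p) => k kn; rewrite [in LHS]inE.
  rewrite offE vopp_vtx addnAC in_seg_opp // !in_seg //=.
  apply/idP/idP => [/andP[kl /forall_inP nadj]|klc].
    suff : k != l.+1 by lia.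
    apply/negP => /eqP kl'; have := nadj (vtx (p + l)).
    by rewrite in_seg // adj_same // kl' eqxx; lia.
  apply/andP; split; first lia.
  apply/forall_inP => v; have [j jn [->|->]] := vtx_cases p v; last by rewrite in_seg_opp.
  by rewrite in_seg // adj_same //; lia.
rewrite vopp_vtx' !in_seg_opp // in_seg //=.
case: (ltnP k l.+1) => [kl|lk]; first by rewrite andbF; lia.
rewrite offE ?vopp_vtx' ?in_seg //=; last lia.
apply/forall_inP/idP => [nadj|kN].
  suff : k != N by lia.
  apply/negP => /eqP kN; have := nadj (vtx (p + 0)).
  by rewrite in_seg // adj_other // kN !eqxx; lia.
move=> v; have [j jn [->|->]] := vtx_cases p v; last by rewrite in_seg_opp.
by rewrite in_seg // adj_other //; lia.
Qed.

(** The multiplicity l + 1 is the number of positions of [vtx q] within an arc of l + 1 vertices. *)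
Lemma peel_whole (W : {set vertex n}) q :
  (forall u, u != vopp (vtx q) -> u \in W) ->
  \sum_(X | [&& tube X, vtx q \in X & X \subset W]) filled_poly X * tubing_poly (off W X) =
  \sum_(l < n) (tube_poly l.+1 * open_ne (n - l.+1)) *+ l.+1.
Proof.
move=> Wu; pose arc (li : 'I_n * 'I_n) := @seg N (q + n.*2 - li.2) 0 li.1.+1 0 0.
pose D := [set li : 'I_n * 'I_n | (li.2 <= li.1)%N].
have arcinj : {in D &, injective arc}.
  move=> [l i] [l' i']; rewrite !inE /= => il i'l' /arc_inj[||ii ll].
  - by rewrite il /=.
  - by rewrite i'l' /=.
  - by congr pair; apply: val_inj.
rewrite (eq_bigl (mem (arc @: D))); last first.
  move=> X; apply/and3P/imsetP => [[tX qX XW]|[[l i]]].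
    have [i [l [il ln XE]]] := tube_arc tX qX; have i_n : (i < n)%N by lia.
    by exists (Ordinal ln, Ordinal i_n); rewrite ?inE.
  rewrite inE /= => il ->; have qX := arc_mem q il (ltn_ord l).
  have tX : tube (arc (l, i)) by apply: seg_tube.
  split=> //; apply/subsetP => u uX; apply: Wu.
  have /and3P[_ _ /pair_freeP Xf] := tX.
  by apply: contraTneq uX => ->; apply: Xf.
rewrite big_imset //=.
transitivity (\sum_(l < n) \sum_(i < n | (i <= l)%N)
    tube_poly l.+1 * open_ne (n - l.+1)).
  rewrite pair_big_dep /=; apply: eq_big => [[l i]|[l i]]; first by rewrite inE.
  rewrite inE /= => il; have ln := ltn_ord l; congr (_ * _).
    exact: (@arc_shape l.+1 N _ 0 _).2.
  rewrite (off_arc ln Wu (arc_mem q il ln)).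
  rewrite /open_ne; set p := (_ - _)%N.
  rewrite -(@tubing_poly_shape N p l.+1) //; [|lia|lia].
  by congr tubing_poly; apply: seg_ext => k kn; lia.
apply: eq_bigr => l _; set c := tube_poly _ * _.
by rewrite -(@big_ord_widen _ _ _ l.+1 n (fun=> c) (ltn_ord l)) sumr_const card_ord.
Qed.

(** Peel at a vertex, and peel what avoids it at the opposite vertex: [peel_whole] gives the same
    sum twice, and two strips of N vertices remain. *)
Lemma cycle_rec : tubing_poly [set: vertex n] =
  strip2 N + (\sum_(l < n) (tube_poly l.+1 * open_ne (n - l.+1)) *+ l.+1) *+ 2.
Proof.
rewrite (@tubing_poly_peel _ (vtx (0 + 0))) ?inE // peel_whole; last by move=> u; rewrite inE.
rewrite (@tubing_poly_peel _ (vtx (0 + n + 0))); last first.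
  by rewrite in_setD1 inE eq_sym vtx_other.
rewrite peel_whole => [|u]; last by rewrite vopp_vtx' in_setD1 inE andbT.
rewrite -addrA -mulr2n; congr (_ + _).
rewrite /strip2 -(@tubing_poly_shape N 0 1) //; congr tubing_poly.
apply: (@vset_eq _ 0) => k kn; rewrite !in_setD1 in_setT andbT.
  by rewrite vtx_other // vtx_same // in_seg //; lia.
by rewrite vtx_same // [vtx _ == vtx (0 + 0)]eq_sym vtx_other // in_seg_opp //; lia.
Qed.

End WholeCycle.

(* Only imported here because classical_sets shadows names of finset. *)
From mathcomp Require Import finmap.
From mathcomp Require Import boolp classical_sets functions cardinality reals.

Local Open Scope classical_set_scope.
Local Open Scope ring_scope.

(** * Faces of simple polytopes *)

Definition for_small (R : realType) (Q : R -> Prop) : Prop :=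
  exists2 e, 0 < e & forall t, 0 < t -> t <= e -> Q t.

Lemma for_small_and (R : realType) (Q Q' : R -> Prop) :
  for_small Q -> for_small Q' -> for_small (fun t => Q t /\ Q' t).
Proof.
move=> [e e0 He] [e' e'0 He']; exists (Num.min e e').
  by rewrite lt_min e0.
move=> t t0; rewrite le_min => /andP[te te'].
by split; [apply: He|apply: He'].
Qed.

Lemma for_small_forall (R : realType) (I : finType) (Q : I -> R -> Prop) :
  (forall i, for_small (Q i)) -> for_small (fun t => forall i, Q i t).
Proof.
move=> QI.
suff [e e0 He] : for_small (fun t => forall i, i \in enum I -> Q i t).
  by exists e => // t t0 te i; apply: He; rewrite ?mem_enum.
elim: (enum I) => [|i s IH]; first by exists 1.
have [e e0 He] := for_small_and (QI i) IH.
exists e => // t t0 te j; have [Hi Hs] := He t t0 te.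
by rewrite inE => /predU1P[->|/Hs].
Qed.

Lemma for_small_ex (R : realType) (Q : R -> Prop) :
  for_small Q -> exists2 t, 0 < t & Q t.
Proof. by move=> [e e0 He]; exists e => //; apply: He. Qed.

Lemma for_small_lt (R : realType) (a b c : R) :
  a < b -> for_small (fun t => a + t * c < b).
Proof.
move=> ab; have c0 : 0 < 2 * (`|c| + 1) by rewrite mulr_gt0 ?ltr_wpDl.
exists ((b - a) / (2 * (`|c| + 1))); first by rewrite divr_gt0 ?subr_gt0.
move=> t t0; rewrite ler_pdivlMr // => H.
have := ler_norm c; nra.
Qed.

Lemma for_small_le (R : realType) (a b c : R) :
  a <= b -> (a = b -> c <= 0) -> for_small (fun t => a + t * c <= b).
Proof.
rewrite le_eqVlt => /predU1P[<- c0|ab _].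
  by exists 1 => // t t0 _; have := c0 erefl; nra.
have [e e0 He] := for_small_lt c ab.
by exists e => // t t0 te; apply/ltW/He.
Qed.

Section PolytopeFaces.
Context {R : realType} {m : nat}.
Implicit Types (F G : set 'rV[R]_m) (x y v : 'rV[R]_m).

(** Rescaling each vector of a basis of L by a positive factor keeps it a basis and brings its
    translate by y into F. *)
Lemma has_dim_span F y r (L : 'M[R]_(r, m)) : F y ->
  (forall z, F z -> (z - y <= L)%MS) ->
  (forall v, (v <= L)%MS -> exists2 e, 0 < e & F (y + e *: v)) ->
  has_dim F (\rank L).
Proof.
move=> Fy FL LF.
have /choice[e He] : forall i, exists e, 0 < e /\ F (y + e *: row i (row_base L)).
  move=> i; have [|e e0 Fe] := LF (row i (row_base L)); last by exists e.
  by rewrite (submx_trans (row_sub _ _)) // eq_row_base.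
pose d := \row_i e i.
have du : diag_mx d \in unitmx.
  rewrite unitmxE det_diag unitfE; apply/prodf_neq0 => i _.
  by rewrite mxE gt_eqF //; have [] := He i.
exists y, (diag_mx d *m row_base L); split=> //.
- move=> i; have -> : row i (diag_mx d *m row_base L) = e i *: row i (row_base L).
    by rewrite mul_diag_mx; apply/rowP => k; rewrite !mxE.
  by have [] := He i.
- rewrite /row_free mxrankMfree ?row_base_free //.
  by rewrite mxrank_unit.
- move=> z /FL zL; apply: (submx_trans zL).
  by rewrite -(eq_row_base L) -{1}[row_base L](mulKmx du) submxMl.
Qed.

Lemma has_dim_unique F k k' : has_dim F k -> has_dim F k' -> k = k'.
Proof.
suff H k1 k2 : has_dim F k1 -> has_dim F k2 -> (k1 <= k2)%N.
  by move=> h h'; apply/eqP; rewrite eqn_leq !H.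
move=> [x [D [Fx FD Dfree _]]] [x' [D' [_ _ Dfree' FD']]].
rewrite -(eqP Dfree) -(eqP Dfree') mxrankS //.
apply/row_subP => i.
have -> : row i D = (x + row i D - x') - (x - x').
  by rewrite opprB addrA subrK addrC addKr.
by rewrite addmx_sub ?eqmx_opp ?FD'.
Qed.

End PolytopeFaces.

Lemma mulmx_valD (R : realType) m q (C : 'M[R]_(m, q)) (x v : 'rV_m) t j :
  ((x + t *: v) *m C) 0 j = (x *m C) 0 j + t * (v *m C) 0 j.
Proof. by rewrite mulmxDl -scalemxAl !mxE. Qed.

Lemma mulmx_valB (R : realType) m q (C : 'M[R]_(m, q)) (x y : 'rV_m) j :
  ((x - y) *m C) 0 j = (x *m C) 0 j - (y *m C) 0 j.
Proof. by rewrite mulmxBl !mxE. Qed.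

Lemma mulmx_valN (R : realType) m q (C : 'M[R]_(m, q)) (x : 'rV_m) j :
  ((- x) *m C) 0 j = - (x *m C) 0 j.
Proof. by rewrite mulNmx !mxE. Qed.

(** * Polyhedra given by inequalities, and their vertices *)

Section HPolytope.
Context {R : realType} {m p : nat} (A : 'M[R]_(m, p)) (b : 'rV[R]_p).
Implicit Types (x y v : 'rV[R]_m) (F : set 'rV[R]_m).

Definition hpoly : set 'rV[R]_m := [set x | forall j, (x *m A) 0 j <= b 0 j].

Definition active x : {set 'I_p} := [set j | (x *m A) 0 j == b 0 j]%SET.

Lemma activeP x j : (j \in active x) = ((x *m A) 0 j == b 0 j).
Proof. by rewrite inE. Qed.

Lemma hpoly_step x v : hpoly x ->
  (forall j, j \in active x -> (v *m A) 0 j <= 0) ->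
  for_small (fun t => hpoly (x + t *: v)).
Proof.
move=> Px vx.
have [e e0 He] : for_small (fun t => forall j,
    (x *m A) 0 j + t * (v *m A) 0 j <= b 0 j).
  apply: for_small_forall => j; apply: for_small_le; first exact: Px.
  by move=> xb; apply: vx; rewrite activeP xb.
by exists e => // t t0 te j; rewrite mulmx_valD; apply: He.
Qed.

Lemma exists_vertex (M : R) y :
  (forall x, hpoly x -> forall i, `|x 0 i| <= M) -> hpoly y ->
  exists x, [/\ hpoly x, active y \subset active x &
    forall v, (forall j, j \in active x -> (v *m A) 0 j = 0) -> v = 0].
Proof.
move=> PM; have [k] := ubnP (p - #|active y|)%N.
elim: k y => // k IH y yk Py.
have [//|] := pselect (forall v,
  (forall j, j \in active y -> (v *m A) 0 j = 0) -> v = 0).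
  by exists y.
move=> /existsNP[v /not_implyP[yv /eqP v0]].
have [j0 vj0] : exists j, 0 < (v *m A) 0 j.
  apply: contrapT => /forallNP vle.
  have Pt t : 0 < t -> hpoly (y + t *: v).
    move=> t0 j; rewrite mulmx_valD; have := Py j.
    by have /negP := vle j; rewrite -leNgt; nra.
  have [i vi] : exists i, v 0 i != 0.
    apply: contrapT => /forallNP vi; move/eqP: v0; apply.
    by apply/rowP => i; rewrite !mxE; apply/eqP; rewrite -[_ == _]negbK; apply/negP/vi.
  have nvi : 0 < `|v 0 i| by rewrite normr_gt0.
  pose t := (`|M| + `|y 0 i| + 1) / `|v 0 i|.
  have t0 : 0 < t by rewrite divr_gt0 // ltr_wpDl // addr_ge0.
  have := PM _ (Pt t t0) i; rewrite !mxE.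
  have : `|t * v 0 i| <= `|y 0 i + t * v 0 i| + `|y 0 i|.
    by have := ler_normB (y 0 i + t * v 0 i) (y 0 i); rewrite addrAC subrr add0r.
  rewrite normrM (gtr0_norm t0) /t divfK ?gt_eqF //.
  have := ler_norm M; have := normr_ge0 (y 0 i); lra.
(* The step length at which constraint j becomes tight; the smallest one keeps the point in the
   polytope. *)
pose ratio j := (b 0 j - (y *m A) 0 j) / (v *m A) 0 j.
have [j vj jmin] := arg_minP ratio (P := fun j => 0 < (v *m A) 0 j) vj0.
set t := ratio j in jmin.
have t0 : 0 <= t by rewrite divr_ge0 ?subr_ge0 ?Py // ltW.
have Py' : hpoly (y + t *: v).
  move=> i; rewrite mulmx_valD.
  have [vi|vi] := leP ((v *m A) 0 i) 0; first by have := Py i; nra.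
  by have := jmin i vi; rewrite /ratio ler_pdivlMr //; lra.
have tj : j \in active (y + t *: v).
  by rewrite activeP mulmx_valD /t /ratio divfK; [rewrite addrC subrK|rewrite gt_eqF].
have yy' : active y \subset active (y + t *: v).
  apply/fintype.subsetP => i iy; rewrite activeP mulmx_valD (yv i iy) mulr0 addr0.
  by rewrite -activeP.
have lt_card : (#|active y| < #|active (y + t *: v)|)%N.
  apply: proper_card; rewrite properE yy'; apply/negP => /fintype.subsetP/(_ _ tj).
  by move=> /yv vj'; move: vj; rewrite vj' ltxx.
have cp : (#|active (y + t *: v)| <= p)%N by rewrite -[leqRHS]card_ord max_card.
have [|x [Px y'x xv]] := IH (y + t *: v) _ Py'.
  by move: yk lt_card cp; rewrite !ltnS; lia.
by exists x; split=> //; apply: (fintype.subset_trans yy').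
Qed.

(** The segment from x to y can be prolonged beyond y inside the polytope, so a functional maximal
    at y is maximal at x too. *)
Lemma face_active x y F : hpoly x -> hpoly y -> active y \subset active x ->
  face hpoly F -> F y -> F x.
Proof.
move=> Px Py yx [c [d [Pc ->]]] [_ yd]; split=> //.
have [t t0 /Pc] : exists2 t, 0 < t & hpoly (y + t *: (y - x)).
  apply: for_small_ex; apply: hpoly_step => // j jy.
  have := fintype.subsetP yx _ jy; move: jy; rewrite !activeP mulmx_valB.
  by move=> /eqP -> /eqP ->; rewrite subrr.
rewrite mulmx_valD mulmx_valB yd => H.
by apply/eqP; rewrite eq_le Pc //=; nra.
Qed.

(** The sum of the inequalities in J is an equality exactly where each of them is. *)
Lemma face_tight (J : {set 'I_p}) :
  face hpoly [set x | hpoly x /\ forall j, j \in J -> (x *m A) 0 j = b 0 j].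
Proof.
pose c := \sum_(j in J) col j A; pose d := \sum_(j in J) b 0 j.
have xc x : (x *m c) 0 0 = \sum_(j in J) (x *m A) 0 j.
  rewrite mulmx_sumr summxE; apply: eq_bigr => j _.
  by rewrite colE mulmxA -colE mxE.
exists c, d; split=> [x Px|]; first by rewrite xc ler_sum.
apply/seteqP; split=> x [Px] /=.
  by move=> xJ; split=> //; rewrite xc; apply: eq_bigr.
rewrite xc => /eqP; rewrite eq_sym -subr_eq0 -sumrB psumr_eq0; last first.
  by move=> j _; rewrite subr_ge0.
by move=> /allP xd; split=> // j jJ; have := xd j (mem_index_enum _);
   rewrite jJ subr_eq0 => /eqP.
Qed.

Lemma face_set1 x : hpoly x ->
  (forall v, (forall j, j \in active x -> (v *m A) 0 j = 0) -> v = 0) <->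
  face hpoly [set x].
Proof.
move=> Px; split=> [xv|[c [d [Pc Fx]]] v xv].
  suff <- : [set y | hpoly y /\ forall j, j \in active x -> (y *m A) 0 j = b 0 j]
    = [set x] by exact: face_tight.
  apply/seteqP; split=> y /=; last first.
    by move=> ->; split=> // j; rewrite activeP => /eqP.
  move=> [_ yb]; apply/subr0_eq/xv => j jx.
  by rewrite mulmx_valB yb //; move: jx; rewrite activeP => /eqP ->; rewrite subrr.
have xd : (x *m c) 0 0 = d.
  by have : [set x] x by []; rewrite Fx => -[].
have [e e0 [P1 P2]] : exists2 t, 0 < t &
    hpoly (x + t *: v) /\ hpoly (x + t *: - v).
  apply/for_small_ex/for_small_and; apply: hpoly_step => // j /xv.
    by move=> ->.
  by rewrite mulmx_valN => ->; rewrite oppr0.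
have : [set x] (x + e *: v).
  rewrite Fx; split=> //; move: (Pc _ P1) (Pc _ P2).
  rewrite !mulmx_valD mulmx_valN xd; lra.
move=> /= /eqP; rewrite addrC -subr_eq0 addrK scaler_eq0 gt_eqF //=.
by move=> /eqP.
Qed.

End HPolytope.

Lemma card_injective_onto (I : finType) (U : choiceType) (g : I -> U)
    (K : {set I}) (C : set U) n :
  (C #= `I_n)%card -> {in K &, injective g} -> (forall j, j \in K -> C (g j)) ->
  (#|K| <= n)%N /\ ((n <= #|K|)%N -> forall y, C y -> exists2 j, j \in K & y = g j).
Proof.
move=> Cn ginj gC; pose S := [fset g j | j in K]%fset.
have Ccard := card_fset_set Cn.
have Cfin : finite_set C by exists n.
have Scard : #|` S| = #|K| by rewrite card_in_imfset //= cardE.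
have SC : (S `<=` fset_set C)%fset.
  by apply/fsubsetP => _ /imfsetP[j jK ->]; rewrite in_fset_set // inE; apply: gC.
split=> [|nK y Cy]; first by rewrite -Scard -Ccard fsubset_leq_card.
have SE : S = fset_set C by apply/eqP; rewrite eqEfcard SC Ccard Scard.
have : y \in S by rewrite SE in_fset_set // inE.
by move=> /imfsetP[j jK ->]; exists j.
Qed.

(** * Cones and faces at a vertex of a simple polytope *)

Section SimpleVertex.
Context {R : realType} {m p n : nat} (A : 'M[R]_(m, p)) (b : 'rV[R]_p).
Implicit Types (x y v : 'rV[R]_m) (D : 'M[R]_(n, m)) (J K : {set 'I_p}).
Local Notation P := (hpoly A b).
Local Notation active := (active A b).

Definition tight J : set 'rV[R]_m :=
  [set x | P x /\ forall j, j \in J -> (x *m A) 0 j = b 0 j].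

Lemma interior_point : has_dim P n ->
  exists (D : 'M[R]_(n, m)) y0, [/\ row_free D, P y0,
    forall x y, P x -> P y -> (x - y <= D)%MS &
    forall j, (y0 *m A) 0 j < b 0 j \/
      forall v, (v <= D)%MS -> (v *m A) 0 j = 0].
Proof.
move=> [x0 [D [Px0 PD Dfree PxD]]].
pose s j := b 0 j - (x0 *m A) 0 j.
pose d i j : R := (D *m A) i j.
have ds i j : d i j <= s j.
  have := PD i j; rewrite -[row i D]scale1r mulmx_valD mul1r -row_mul.
  by rewrite [row _ _ _ _]mxE /d /s; lra.
(* The barycentre of the n + 1 affinely independent points. Its slack in a constraint is the mean of
   theirs, so it vanishes only if all of them do, and the constraint is then constant along D. *)
pose y0 : 'rV[R]_m := x0 + n.+1%:R^-1 *: (const_mx 1 *m D).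
have n0 : 0 < n.+1%:R :> R by [].
have y0E j : n.+1%:R * (b 0 j - (y0 *m A) 0 j) = s j + \sum_i (s j - d i j).
  rewrite /y0 mulmx_valD -mulmxA [(const_mx _ *m _) _ _]mxE.
  under eq_bigr do rewrite mxE mul1r -/(d _ _).
  rewrite mulrBr mulrDr mulrA divff ?gt_eqF //.
  rewrite mul1r sumrB sumr_const card_ord /s /d -mulr_natr -addn1 natrD; ring.
have s0 j : 0 <= s j by rewrite subr_ge0 Px0.
have sd0 j : 0 <= \sum_i (s j - d i j) by apply: sumr_ge0 => i _; rewrite subr_ge0.
have Py0 : P y0 by move=> j; rewrite -subr_ge0 -(pmulr_rge0 _ n0) y0E addr_ge0.
exists D, y0; split=> //.
- move=> x y Px Py.
  have -> : x - y = (x - x0) - (y - x0) by rewrite opprB addrA subrK.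
  by rewrite addmx_sub ?eqmx_opp ?PxD.
- move=> j; have [ye|ne0] := eqVneq (b 0 j) ((y0 *m A) 0 j); last first.
    by left; rewrite lt_def ne0 Py0.
  right=> v /submxP[u ->].
  have /eqP := y0E j; rewrite ye subrr mulr0 eq_sym paddr_eq0 //.
  move=> /andP[/eqP sj0 /eqP/psumr_eq0P dj0].
  rewrite -mulmxA mxE big1 // => i _.
  have /eqP : s j - d i j = 0 by apply: dj0 => // k _; rewrite subr_ge0.
  by rewrite subr_eq0 sj0 ; rewrite /d => /eqP <-; rewrite mulr0.
Qed.

Definition colset J (B : 'M[R]_(n, p)) : 'M[R]_(n, #|J|) :=
  colsub (@enum_val _ (mem J)) B.

Lemma sub_ker_colset D J v :
  (v <= kermx (colset J (D *m A)) *m D)%MS <->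
  (v <= D)%MS /\ forall j, j \in J -> (v *m A) 0 j = 0.
Proof.
split.
  move=> /submxP[w ->]; split; first by rewrite mulmxA submxMl.
  move=> j jJ; have : w *m kermx (colset J (D *m A)) *m colset J (D *m A) = 0.
    by rewrite -mulmxA mulmx_ker mulmx0.
  rewrite mulmx_colsub => /rowP/(_ (enum_rank_in jJ j)).
  by rewrite !mulmxA [LHS]mxE enum_rankK_in // => ->; rewrite mxE.
move=> [/submxP[u ->] uJ]; rewrite submxMr //; apply/sub_kermxP.
apply/rowP => k; rewrite mulmx_colsub [LHS]mxE mulmxA uJ ?mxE //.
exact: (enum_valP k).
Qed.

(** The last hypothesis places u in the relative interior of the cone of feasible directions
    annihilating J. After a short step from x along u, all directions in D annihilating J are
    feasible, so they span the face. *)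
Lemma tight_dim D J x u : row_free D ->
  (forall y z, P y -> P z -> (y - z <= D)%MS) ->
  P x -> J \subset active x -> (u <= D)%MS ->
  (forall j, j \in J -> (u *m A) 0 j = 0) ->
  (forall v, (v <= D)%MS -> (forall j, j \in J -> (v *m A) 0 j = 0) ->
     exists2 s, 0 < s & forall j, j \in active x -> ((u + s *: v) *m A) 0 j <= 0) ->
  has_dim (tight J) (n - \rank (colset J (D *m A))) /\
  (exists2 y, tight J y & forall j, (u *m A) 0 j < 0 -> (y *m A) 0 j < b 0 j).
Proof.
move=> Dfree PD Px Jx uD uJ us.
have ux j : j \in active x -> (u *m A) 0 j <= 0.
  have [||s s0 us0] := us 0; rewrite ?sub0mx //.
    by move=> i _; rewrite mul0mx mxE.
  by move=> /us0; rewrite scaler0 addr0.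
have [e e0 [Py ylt]] : exists2 e, 0 < e & P (x + e *: u) /\
    forall j, j \notin active x -> ((x + e *: u) *m A) 0 j < b 0 j.
  apply/for_small_ex/for_small_and; first exact: hpoly_step.
  apply: for_small_forall => j; case: (boolP (j \in active x)) => jx.
    by exists 1.
  have [|d d0 Hd] := for_small_lt (a := (x *m A) 0 j) (b := b 0 j) ((u *m A) 0 j).
    by rewrite lt_neqAle Px -activeP jx.
  by exists d => // t t0 td _; rewrite mulmx_valD; apply: Hd.
set y := x + e *: u in Py ylt.
have xb j : j \in active x -> (x *m A) 0 j = b 0 j by rewrite activeP => /eqP.
have yJ : tight J y.
  split=> // j jJ; rewrite mulmx_valD uJ // mulr0 addr0.
  exact/xb/(fintype.subsetP Jx).
split; last first.
  exists y => // j uj; case: (boolP (j \in active x)) => [jx|/ylt//].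
  rewrite mulmx_valD xb //; nra.
rewrite -mxrank_ker -(mxrankMfree _ Dfree).
apply: (has_dim_span yJ) => [z [Pz zJ]|v /sub_ker_colset[vD vJ]].
  apply/sub_ker_colset; split=> [|j jJ]; first exact: PD.
  by rewrite mulmx_valB zJ // (yJ.2 j jJ) subrr.
have vy j : j \in active y -> (v *m A) 0 j = 0.
  move=> jy; have jx : j \in active x.
    apply: contraTT jy => /ylt; rewrite activeP lt_neqAle => /andP[]; by [].
  have uj : (u *m A) 0 j = 0.
    move: jy; rewrite activeP mulmx_valD xb // -subr_eq0 addrAC subrr add0r.
    by rewrite mulf_eq0 gt_eqF //= => /eqP.
  have [s s0 /(_ j jx)] := us v vD vJ.
  have [||s' s'0 /(_ j jx)] := us (- v); rewrite ?eqmx_opp //.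
    by move=> i /vJ vi; rewrite mulmx_valN vi oppr0.
  rewrite !mulmx_valD mulmx_valN uj !add0r => h1 h2.
  by apply/eqP; rewrite eq_le -(pmulr_rle0 _ s0) h2 -oppr_le0 -(pmulr_rle0 _ s'0).
have [t t0 Pt] : exists2 t, 0 < t & P (y + t *: v).
  by apply/for_small_ex/hpoly_step => // j /vy ->.
exists t => //; split=> // j jJ; rewrite mulmx_valD (yJ.2 j jJ) vJ //.
by rewrite mulr0 addr0.
Qed.

End SimpleVertex.

Section SimplePolytope.
Context {R : realType} {m p n : nat} (A : 'M[R]_(m, p)) (b : 'rV[R]_p).
Implicit Types (x y z v : 'rV[R]_m) (F G : set 'rV[R]_m) (J K : {set 'I_p}).
Local Notation P := (hpoly A b).
Local Notation active := (active A b).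
Local Notation tight := (tight A b).

Lemma rank_colset J (B : 'M[R]_(n, p)) :
  (forall t : 'I_p -> R, exists u : 'rV_n, forall j, j \in J -> (u *m B) 0 j = t j) ->
  \rank (colset J B) = #|J|.
Proof.
move=> Bt; apply/eqP; rewrite -/(row_full _) -sub1mx; apply/row_subP => k.
have [u uB] := Bt (fun j => (j == enum_val k)%:R).
apply/submxP; exists u; apply/rowP => l.
rewrite mulmx_colsub row1 [RHS]mxE uB; last exact: (enum_valP l).
by rewrite mxE eqxx /= (inj_eq enum_val_inj).
Qed.

(* At a vertex of a simple polytope the cone of feasible directions is          *)
(* simplicial: it is cut out by n constraints that are independent on the       *)
(* direction space D, one for each facet through the vertex.                    *)
Lemma simple_vertex_cone x : has_dim P n -> face P [set x] ->
  ([set F | facets P F /\ F x] #= `I_n)%card ->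
  exists (D : 'M[R]_(n, m)) K, [/\ row_free D,
    forall y z, P y -> P z -> (y - z <= D)%MS, K \subset active x,
    (forall v, (v <= D)%MS -> (forall j, j \in K -> (v *m A) 0 j <= 0) ->
       forall j, j \in active x -> (v *m A) 0 j <= 0) &
    (forall t : 'I_p -> R, exists2 v : 'rV_m, (v <= D)%MS &
       forall j, j \in K -> (v *m A) 0 j = t j) /\
    [/\ (forall j, j \in K -> facets P (tight [set j]%SET)),
      {in K &, injective (fun j => tight [set j]%SET)} &
      forall F, facets P F -> F x -> exists2 j, j \in K & F = tight [set j]%SET]].
Proof.
move=> dP fx nfx.
have Px : P x by case: fx => c [d [_ Fx]]; have : [set x] x by []; rewrite Fx => -[].
have xv := (face_set1 Px).2 fx.
have [D [y0 [Dfree Py0 PD y0b]]] := interior_point dP.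
pose cone K := `[< forall v, (v <= D)%MS ->
  (forall j, j \in K -> (v *m A) 0 j <= 0) ->
  forall j, j \in active x -> (v *m A) 0 j <= 0 >].
pose C := [set j in active x | (y0 *m A) 0 j < b 0 j]%SET.
have coneC : cone C.
  apply/asboolP => v vD vC j jx; have [y0j|vj] := y0b j; last by rewrite vj.
  by apply: vC; rewrite inE jx.
(* K is an irredundant set of constraints cutting out the cone within D, chosen among those strict
   at the interior point y0. *)
have [K /minsetP[/asboolP Kcone Kmin] KC] := minset_exists coneC.
have Kx : K \subset active x.
  by apply: fintype.subset_trans KC _; apply/fintype.subsetP => j; rewrite inE => /andP[].
have xb j : j \in K -> (x *m A) 0 j = b 0 j.
  by move=> /(fintype.subsetP Kx); rewrite activeP => /eqP.
pose w : 'rV_m := y0 - x.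
have wD : (w <= D)%MS by exact: PD.
have wK j : j \in K -> (w *m A) 0 j < 0.
  move=> jK; rewrite mulmx_valB xb // subr_lt0.
  by have := fintype.subsetP KC _ jK; rewrite inE => /andP[].
have uK j : j \in K -> exists u : 'rV_m, [/\ (u <= D)%MS, (u *m A) 0 j = 0 &
    forall i, i \in K -> i != j -> (u *m A) 0 i < 0].
  move=> jK.
  have : ~ cone (K :\ j)%SET.
    move=> /Kmin/(_ (subD1set _ _)) KE.
    by have := setD11 j K; rewrite KE jK.
  move=> /negP/asboolPn/existsNP[v /not_implyP[vD /not_implyP[vK /existsNP[i0]]]].
  move=> /not_implyP[i0x /negP]; rewrite -ltNge => vi0.
  have vj : 0 < (v *m A) 0 j.
    rewrite ltNge; apply/negP => vj; move: vi0; rewrite ltNge => /negP; apply.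
    apply: Kcone i0x => // i iK; have [->//|ij] := eqVneq i j.
    by apply: vK; rewrite !inE ij.
  (* By irredundance v violates constraint j and no other in K. Adding this multiple of the interior
     direction w cancels the value at j and makes the others negative. *)
  exists (v + ((v *m A) 0 j / - (w *m A) 0 j) *: w); split.
  - by rewrite addmx_sub // scalemx_sub.
  - rewrite mulmx_valD invrN mulrN mulNr divfK ?subrr //.
    by rewrite lt_eqF // wK.
  - move=> i iK ij; rewrite mulmx_valD.
    have : (v *m A) 0 i <= 0 by apply: vK; rewrite !inE ij.
    have : 0 < (v *m A) 0 j / - (w *m A) 0 j by rewrite divr_gt0 // oppr_gt0 wK.
    have := wK i iK; nra.
have single j (jK : j \in K) :
    has_dim (tight [set j]%SET) (n - 1) /\
    exists2 y, tight [set j]%SET y &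
      forall i, i \in K -> i != j -> (y *m A) 0 i < b 0 i.
  have [u [uD uj uneg]] := uK j jK.
  have r1 : \rank (colset [set j]%SET (D *m A)) = 1%N.
    rewrite rank_colset ?cards1 // => t.
    have /submxP[c wE] := wD.
    exists ((t j / (w *m A) 0 j) *: c) => i; rewrite inE => /eqP ->.
    rewrite -scalemxAl mulmxA -wE mxE divfK //.
    by rewrite lt_eqF // wK.
  have [] := @tight_dim _ _ _ _ A b D [set j]%SET x u Dfree PD Px _ uD.
  - by rewrite finset.sub1set; apply: (fintype.subsetP Kx).
  - by move=> i; rewrite inE => /eqP ->.
  - move=> v vD vj.
    have [s s0 us] : exists2 s, 0 < s & forall i, i \in K -> i != j ->
        (u *m A) 0 i + s * (v *m A) 0 i < 0.
      apply/for_small_ex/for_small_forall => i.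
      case: (boolP ((i \in K) && (i != j))) => [/andP[iK ij]|nij].
        have [e e0 He] := for_small_lt ((v *m A) 0 i) (uneg i iK ij).
        by exists e => // t t0 te _ _; apply: He.
      by exists 1 => // t _ _ iK ij; rewrite iK ij in nij.
    exists s => //; apply: Kcone; first by rewrite addmx_sub // scalemx_sub.
    move=> i iK; rewrite mulmx_valD; have [->|ij] := eqVneq i j; last exact/ltW/us.
    by rewrite uj vj ?inE // mulr0 addr0.
  - rewrite r1 => dj [y yj ylt]; split=> //; exists y => // i iK ij.
    by apply: ylt; apply: uneg.
have facet j : j \in K -> facets P (tight [set j]%SET) /\ tight [set j]%SET x.
  move=> jK; split; last first.
    by split=> // i; rewrite inE => /eqP ->; apply: xb.
  have n0 : (0 < n)%N.
    apply: leq_trans (rank_leq_row D); apply: leq_trans (mxrankS wD).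
    rewrite rank_rV lt0b; apply/negP => /eqP w0.
    by have := wK j jK; rewrite w0 mul0mx mxE ltxx.
  exists n.-1; rewrite prednK //; split=> //; split; first exact: face_tight.
  by rewrite -subn1; have [] := single j jK.
have tinj : {in K &, injective (fun j => tight [set j]%SET)}.
  move=> i j iK jK /= ijE; apply: contrapT => /eqP ij.
  have [_ [y yi /(_ j jK)]] := single i iK.
  by rewrite eq_sym ij => /(_ isT); move: yi; rewrite ijE => -[_ -> //]; rewrite ?ltxx ?inE.
have [Kn Ksurj] := card_injective_onto nfx tinj facet.
(* A direction annihilated by K lies in the cone together with its negative, so all active
   constraints annihilate it and it is zero at a vertex. Hence K has at least n elements, and by
   simplicity exactly n. *)
have MK : row_free (colset K (D *m A)).
  apply: inj_row_free => u uM0.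
  suff : u *m D = 0 by move=> uD0; apply: (row_free_inj Dfree); rewrite uD0 mul0mx.
  have u0 j : j \in K -> (u *m D *m A) 0 j = 0.
    move=> jK; move/rowP/(_ (enum_rank_in jK j)): uM0.
    by rewrite mulmx_colsub [LHS]mxE enum_rankK_in // mulmxA => ->; rewrite mxE.
  apply: xv => j jx; apply/eqP; rewrite eq_le.
  have uDD : (u *m D <= D)%MS by rewrite submxMl.
  rewrite Kcone //=; last by move=> i /u0 ->.
  rewrite -oppr_le0 -mulmx_valN Kcone ?eqmx_opp //.
  by move=> i /u0 ui; rewrite mulmx_valN ui oppr0.
have nK : (n <= #|K|)%N by rewrite -(eqP MK) rank_leq_col.
have Mfull : row_full (colset K (D *m A)).
  by rewrite /row_full (eqP MK) eqn_leq nK Kn.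
exists D, K; split=> //; split=> [t|]; last first.
  by split=> [j /facet[]|//|F fF Fx]; last exact: Ksurj.
have [B BM] := row_fullP Mfull.
exists ((\row_k t (enum_val k)) *m B *m D); first by rewrite submxMl.
move=> j jK; have := congr1 (fun X => (\row_k t (enum_val k)) *m X) BM.
rewrite mulmx1 mulmxA mulmx_colsub => /rowP/(_ (enum_rank_in jK j)).
by rewrite !mulmxA [LHS]mxE enum_rankK_in // => ->; rewrite mxE enum_rankK_in.
Qed.

(** The midpoint of two points of a face is strict in every constraint where either of them is. *)
Lemma face_strict F y (s : seq 'I_p) : face P F -> F y ->
  (forall j, j \in s -> exists2 z, F z & (z *m A) 0 j < b 0 j) ->
  exists2 z, F z & forall j, j \in s -> (z *m A) 0 j < b 0 j.
Proof.
move=> [c [d [Pc ->]]] Fy; elim: s => [|j s IH] sF; first by exists y.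
have [|z [Pz zd] zs] := IH; first by move=> i iS; apply: sF; rewrite inE iS orbT.
have [|z' [Pz' z'd] z'j] := sF j; first by rewrite mem_head.
exists (z + 2%:R^-1 *: (z' - z)).
  split; last by rewrite /= mulmx_valD mulmx_valB zd z'd subrr mulr0 addr0.
  by move=> i; rewrite mulmx_valD mulmx_valB; have := Pz i; have := Pz' i; lra.
move=> i; rewrite inE mulmx_valD mulmx_valB => /predU1P[->|/zs].
  by have := Pz j; lra.
by have := Pz' i; lra.
Qed.

Section Bounded.
Context (M : R) (PM : forall x, P x -> forall i, `|x 0 i| <= M)
  (dP : has_dim P n)
  (sP : forall x, face P [set x] -> ([set F | facets P F /\ F x] #= `I_n)%card).

(** Facets through y also pass through a vertex x with more active constraints. There they are given
    by a subset J of the coordinates K, so the claim is one about a coordinate face of a simplicial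
    cone. *)
Lemma simplex_face (S : set (set 'rV[R]_m)) y :
  S `<=` facets P -> P y -> (forall G, S G -> G y) ->
  let FS := [set z | P z /\ forall G, S G -> G z] in
  exists Sf : {fset set 'rV[R]_m},
    [/\ S = [set` Sf], (#|` Sf| <= n)%N, face P FS, has_dim FS (n - #|` Sf|) &
      forall G, facets P G -> FS `<=` G -> S G].
Proof.
move=> SP Py Sy FS.
have [x [Px yx xv]] := exists_vertex PM Py.
have fx := (face_set1 Px).1 xv.
have Sx G : S G -> G x.
  move=> SG; have [d [_ [fG _]]] := SP _ SG.
  by apply: (face_active Px Py yx fG); apply: Sy.
have [D [K [Dfree PD Kx Kcone [Kt [Kf Kinj Kx_facet]]]]] :=
  simple_vertex_cone dP fx (sP fx).
pose J := [set j in K | `[< S (tight [set j]%SET) >]]%SET.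
have JK : J \subset K by apply/fintype.subsetP => j; rewrite inE => /andP[].
have SJ G : S G -> exists2 j, j \in J & G = tight [set j]%SET.
  move=> SG; have [j jK GE] := Kx_facet G (SP _ SG) (Sx _ SG).
  by exists j => //; rewrite inE jK; apply/asboolP; rewrite -GE.
have JS j : j \in J -> S (tight [set j]%SET) by rewrite inE => /andP[_ /asboolP].
have FSE : FS = tight J.
  apply/seteqP; split=> z [Pz zS]; split=> //.
    by move=> j /JS/zS[_]; apply; rewrite inE.
  by move=> G /SJ[j jJ ->]; split=> // i; rewrite inE => /eqP ->; apply: zS.
have rJ : \rank (colset J (D *m A)) = #|J|.
  apply: rank_colset => t; have [v /submxP[u ->] vt] := Kt t.
  by exists u => j /(fintype.subsetP JK)/vt <-; rewrite mulmxA.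
(* The direction with coordinates 0 on J and -1 on the rest of K points into the relative interior
   of that face. *)
have [u uD uK] := Kt (fun j => - (j \notin J)%:R).
have [|||dFS [z zJ zlt]] := @tight_dim _ _ _ _ A b D J x u Dfree PD Px _ uD.
- exact: fintype.subset_trans JK Kx.
- by move=> j jJ; rewrite uK ?(fintype.subsetP JK) // jJ oppr0.
- move=> v vD vJ.
  have [s s0 us] : exists2 s, 0 < s & forall i, i \in K -> i \notin J ->
      (u *m A) 0 i + s * (v *m A) 0 i < 0.
    apply/for_small_ex/for_small_forall => i.
    case: (boolP ((i \in K) && (i \notin J))) => [/andP[iK iJ]|nij].
      have [|e e0 He] := for_small_lt (a := (u *m A) 0 i) (b := 0) ((v *m A) 0 i).
        by rewrite uK // iJ oppr_lt0.
      by exists e => // t t0 te _ _; apply: He.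
    by exists 1 => // t _ _ iK iJ; rewrite iK iJ in nij.
  exists s => //; apply: Kcone; first by rewrite addmx_sub // scalemx_sub.
  move=> i iK; rewrite mulmx_valD; have [iJ|iJ] := boolP (i \in J); last exact/ltW/us.
  by rewrite uK // iJ oppr0 vJ // mulr0 addr0.
have Jinj : {in J &, injective (fun j => tight [set j]%SET)}.
  by move=> i j /(fintype.subsetP JK) iK /(fintype.subsetP JK) jK; apply: Kinj.
exists [fset tight [set j]%SET | j in J]%fset.
rewrite card_in_imfset //= -cardE FSE -{2}rJ; split=> //.
- apply/seteqP; split=> [G /SJ[j jJ ->]|G /imfsetP[j jJ ->]]; last exact: JS.
  by apply/imfsetP; exists j.
- by rewrite -rJ rank_leq_row.
- exact: face_tight.
move=> G fG JG; have Gx : G x.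
  apply: JG; split=> // j /(fintype.subsetP JK)/(fintype.subsetP Kx).
  by rewrite activeP => /eqP.
have [j jK GE] := Kx_facet G fG Gx; rewrite GE; apply: JS.
apply: contrapT => /negP jJ; have := JG z zJ; rewrite GE => -[_ /(_ j)].
rewrite inE eqxx => /(_ isT) zj; have := zlt j.
by rewrite uK // jJ oppr_lt0 ltr01 zj ltxx => /(_ isT).
Qed.

(** At a vertex x of F, take x1 in F strict on the facets through x that do not contain F. If z lies
    in all facets containing F, one can move from x along a direction leading slightly away from z;
    maximality of the functional of F then forces z into F. *)
Lemma face_simplex F y : face P F -> F y ->
  F = [set z | P z /\ forall G, facets P G -> F `<=` G -> G z].
Proof.
move=> fF Fy; have FP z : F z -> P z by case: fF => c [d [_ ->]] [].
have [x [Px yx xv]] := exists_vertex PM (FP _ Fy).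
have Fx := face_active Px (FP _ Fy) yx fF Fy.
have fx := (face_set1 Px).1 xv.
have [D [K [Dfree PD Kx Kcone [Kt [Kf Kinj Kx_facet]]]]] :=
  simple_vertex_cone dP fx (sP fx).
pose J := [set j in K | `[< F `<=` tight [set j]%SET >]]%SET.
have FJ z j : F z -> j \in J -> (z *m A) 0 j = b 0 j.
  by move=> Fz; rewrite inE => /andP[_ /asboolP/(_ z Fz)[_]]; apply; rewrite inE.
have [|x1 Fx1 x1lt] := face_strict (s := enum (K :\: J)%SET) fF Fy.
  move=> j; rewrite mem_enum !inE => /andP[]; rewrite negb_and => /orP[/negP//|].
  move=> /asboolPn FnJ jK; apply: contrapT => nF; apply: FnJ => z Fz.
  split; first exact: FP.
  move=> i; rewrite inE => /eqP ->; apply/eqP; rewrite eq_le FP //= leNgt.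
  by apply/negP => zj; apply: nF; exists z.
apply/seteqP; split=> [z Fz|z [Pz zG]]; first by split=> [|G _]; [exact: FP|apply].
have zJ j : j \in J -> (z *m A) 0 j = b 0 j.
  rewrite inE => /andP[jK /asboolP FT].
  by have [_] := zG _ (Kf j jK) FT; apply; rewrite inE.
have xb j : j \in K -> (x *m A) 0 j = b 0 j.
  by move=> /(fintype.subsetP Kx); rewrite activeP => /eqP.
have [e e0 eK] : exists2 e, 0 < e & forall j, j \in K ->
    ((x1 - x + e *: (x1 - z)) *m A) 0 j <= 0.
  apply/for_small_ex/for_small_forall => j.
  have [jK|jK] := boolP (j \in K); last by exists 1.
  have [d d0 Hd] : for_small (fun t =>
      ((x1 - x) *m A) 0 j + t * ((x1 - z) *m A) 0 j <= 0).
    apply: for_small_le; rewrite !mulmx_valB xb //; first by rewrite subr_le0 FP.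
    have [jJ _|jJ x1j] := boolP (j \in J); first by rewrite FJ // zJ // subrr.
    have : (x1 *m A) 0 j < b 0 j by apply: x1lt; rewrite mem_enum finset.inE jJ.
    by move/eqP: x1j; rewrite subr_eq0 => /eqP ->; rewrite ltxx.
  by exists d => // t t0 td _; rewrite mulmx_valD; apply: Hd.
have [t t0 Pt] : exists2 t, 0 < t & P (x + t *: (x1 - x + e *: (x1 - z))).
  apply/for_small_ex/hpoly_step => //; apply: Kcone => //.
  by apply: addmx_sub; [|apply: scalemx_sub]; apply: PD => //; apply: FP.
move: fF Fx Fx1 Pt => [c [d [Pc ->]]] [_ xd] [_ x1d] /Pc.
rewrite mulmx_valD mulmx_valD !mulmx_valB /= in xd x1d *; rewrite xd x1d.
have te : 0 < t * e by rewrite mulr_gt0.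
by move=> H; split=> //; apply/eqP; rewrite eq_le Pc //=; nra.
Qed.

End Bounded.

End SimplePolytope.

(** The face of a tubing is the intersection of the facets of its tubes. The tubing is recovered as
    the set of tubes whose facets contain that face, and every nonempty face arises so. *)
Lemma nfaces_tubings (R : realType) m n (P : set 'rV[R]_m) k :
  twisted_cycle_associahedron n P ->
  nfaces P k = if (k <= n)%N then ntubings n (n - k) else 0%N.
Proof.
move=> [[[[p [A [b PE]]] [M PM]] sP] dP [phi [[phif phiinj phisurj] phiP]]].
have {}PE : P = hpoly A b by [].
have {}sP x := sP n x dP; subst P.
pose Psi (S : {set {set vertex n}}) : set 'rV[R]_m :=
  [set z | hpoly A b z /\ forall G, (phi @` [set` S]) G -> G z].
(* Written additively so that T is empty when k > n, where n - k would be truncated to 0. *)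
pose T := [set S : {set {set vertex n}} | tubing S & (#|S| + k == n)%N]%SET.
have tubes (S : {set {set vertex n}}) : tubing S -> forall B, B \in S -> tube B.
  by move=> /and3P[/forall_inP].
have PsiT S : tubing S -> [/\ (#|S| <= n)%N, face (hpoly A b) (Psi S),
    has_dim (Psi S) (n - #|S|) &
    forall B, tube B -> Psi S `<=` phi B -> B \in S].
  move=> Stub; have [SP [y [Py Sy]]] := (phiP S (tubes S Stub)).1 Stub.
  have [Sf [SfE Sfn fS dS Smax]] := simplex_face PM dP sP SP Py Sy.
  have Sfcard : #|` Sf| = #|S|.
    have -> : Sf = [fset phi B | B in S]%fset.
      apply/fsetP => G; apply/idP/imfsetP => /=.
        move=> GS; have : [set` Sf] G by [].
        by rewrite -SfE => -[B /= BS <-]; exists B.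
      by move=> [B BS ->]; have : (phi @` [set` S]) (phi B); [exists B|rewrite SfE].
    rewrite card_in_imfset //= ?cardE // => B B' BS B'S.
    by apply: phiinj; rewrite inE; apply: (tubes S).
  rewrite Sfcard in Sfn dS; split=> // B tB /(Smax (phi B) (phif _ tB))[B' B'S].
  move=> /phiinj <- //; rewrite inE //=.
  exact: (tubes S).
have PsiE : faces_of_dim (hpoly A b) k = [set` [fset Psi S | S in T]%fset].
  apply/seteqP; split=> F; last first.
    move=> /imfsetP[S /=]; rewrite inE => /andP[/PsiT[Sn fS dS _]] /eqP Sk ->.
    by have -> : k = (n - #|S|)%N by rewrite -[X in (X - _)%N]Sk addKn.
  move=> [fF dF]; have [y [_ [Fy _ _ _]]] := dF.
  have FE := face_simplex PM dP sP fF Fy.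
  pose S := [set B | tube B && `[< F `<=` phi B >]]%SET.
  have SE : phi @` [set` S] = [set G | facets (hpoly A b) G /\ F `<=` G].
    apply/seteqP; split=> G /=.
      move=> [B /=]; rewrite inE => /andP[tB /asboolP FB] <-; split=> //.
      exact: phif.
    move=> [fG FG]; have [B tB BG] := phisurj _ fG.
    by exists B => //=; rewrite inE BG; apply/andP; split=> //; apply/asboolP.
  have St : tubing S.
    apply: (phiP S _).2 => [B|]; first by rewrite inE => /andP[].
    rewrite SE; split=> [G []//|]; exists y; split=> [|G [_]]; last exact.
    by case: fF Fy => c [d [_ ->]] [].
  have FPsi : F = Psi S.
    by rewrite {1}FE /Psi SE; apply/seteqP; split=> z [Pz zG]; split=> // G;
       [case; exact: zG|move=> *; exact: zG].
  apply/imfsetP; exists S => //=; rewrite inE St /=.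
  have [Sn _ dS _] := PsiT S St; rewrite -FPsi in dS.
  by have kE := has_dim_unique dF dS; rewrite kE subnKC.
rewrite /nfaces PsiE set_fsetK card_in_imfset /=; last first.
  move=> S S'; rewrite !inE => /andP[St _] /andP[S't _] SS'.
  have [_ _ _ Smax] := PsiT S St; have [_ _ _ S'max] := PsiT S' S't.
  apply/eqP; rewrite finset.eqEsubset; apply/andP; split; apply/fintype.subsetP => B BS.
    apply: S'max; first exact: (tubes S).
    by rewrite -SS' => z [_]; apply; exists B.
  apply: Smax; first exact: (tubes S').
  by rewrite SS' => z [_]; apply; exists B.
rewrite -cardE; case: leqP => kn.
  by apply: eq_card => S; rewrite !inE; congr andb; apply/eqP/eqP; lia.
apply: eq_card0 => S; rewrite !inE; apply/negP => /andP[_ /eqP]; lia.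
Qed.

(** * Generating functions *)

Definition series (R : comNzRingType) : Type := nat -> R.

Section Series.
Context {R : comNzRingType}.
Implicit Types f g h : series R.

HB.instance Definition _ := GRing.Zmodule.copy (series R) (nat -> R).

Definition series_one : series R := fun n => (n == 0%N)%:R.

Definition series_mul f g : series R := fun n => \sum_(i < n.+1) f i * g (n - i)%N.

(** Each coefficient of a product is one of truncated polynomials, from which associativity and
    commutativity are inherited. *)
Lemma series_mul_coef m n f g : (n < m)%N ->
  series_mul f g n = (\poly_(i < m) f i * \poly_(i < m) g i)`_n.
Proof.
move=> nm; rewrite coefM; apply: eq_bigr => i _; have := ltn_ord i => il.
by rewrite !coef_poly !(leq_ltn_trans _ nm) // leq_subr.
Qed.

Lemma series_mulA : associative series_mul.
Proof.
move=> f g h; apply/funext => n; pose T (k : series R) := \poly_(i < n.+1) k i.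
transitivity ((T f * (T g * T h))`_n).
  rewrite coefM; apply: eq_bigr => i _; have il := ltn_ord i.
  by rewrite coef_poly il (@series_mul_coef n.+1) // ltnS leq_subr.
rewrite mulrA coefM; apply: eq_bigr => i _; have il := ltn_ord i.
by rewrite coef_poly ltnS leq_subr (@series_mul_coef n.+1).
Qed.

Lemma series_mulC : commutative series_mul.
Proof.
by move=> f g; apply/funext => n; rewrite !(@series_mul_coef n.+1) // mulrC.
Qed.

Lemma series_mul1 : left_id series_one series_mul.
Proof.
move=> f; apply/funext => n; rewrite /series_mul big_ord_recl subn0 mul1r big1 ?addr0 //.
by move=> i _; rewrite /series_one mul0r.
Qed.

Lemma series_mulDl : left_distributive series_mul +%R.
Proof.
move=> f g h; apply/funext => n; rewrite -[RHS]big_split.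
by apply: eq_bigr => i _; apply: mulrDl.
Qed.

Lemma series_one_neq0 : series_one != 0 :> series R.
Proof. by apply/eqP => /(congr1 (fun f : series R => f 0%N))/eqP; rewrite oner_eq0. Qed.

HB.instance Definition _ := GRing.Zmodule_isComNzRing.Build (series R)
  series_mulA series_mulC series_mul1 series_mulDl series_one_neq0.

Lemma series_addE f g n : (f + g) n = f n + g n. Proof. by []. Qed.

Lemma series_oppE f n : (- f) n = - f n. Proof. by []. Qed.

Lemma series_oneE n : (1 : series R) n = (n == 0%N)%:R. Proof. by []. Qed.

Lemma series_mulE f g n : (f * g) n = \sum_(i < n.+1) f i * g (n - i)%N.
Proof. by []. Qed.

Definition series_C (c : R) : series R := fun n => if n is 0 then c else 0.

Definition series_X : series R := fun n => (n == 1%N)%:R.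

Lemma series_mulC0 f g n : f 0%N = 0 ->
  (f * g) n = \sum_(i < n) f i.+1 * g (n - i.+1)%N.
Proof. by move=> f0; rewrite series_mulE big_ord_recl f0 mul0r add0r. Qed.

Lemma series_CE c f n : (series_C c * f) n = c * f n.
Proof.
rewrite series_mulE big_ord_recl subn0 big1 ?addr0 // => i _.
by rewrite mul0r.
Qed.

Lemma series_CD c d : series_C (c + d) = series_C c + series_C d.
Proof. by apply/funext => -[|n]; rewrite series_addE //= addr0. Qed.

Lemma series_CM c d : series_C (c * d) = series_C c * series_C d.
Proof. by apply/funext => n; rewrite series_CE; case: n => //=; rewrite mulr0. Qed.

Lemma series_Cnat k : series_C k%:R = k%:R.
Proof.
elim: k => [|k IH]; first by apply/funext => -[].
by rewrite -addn1 natrD series_CD IH natrD; congr (_ + _); apply/funext => -[].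
Qed.

Lemma series_XE f n : (series_X * f) n = if n is m.+1 then f m else 0.
Proof.
rewrite series_mulC0 //; case: n => [|n]; first by rewrite big_ord0.
rewrite big_ord_recl mul1r subn1 big1 ?addr0 // => i _.
by rewrite /series_X mul0r.
Qed.

(* The operator y d/dy in the variable y = series_X. *)
Definition series_euler f : series R := fun n => f n *+ n.

Lemma series_eulerD f g : series_euler (f + g) = series_euler f + series_euler g.
Proof. by apply/funext => n; rewrite series_addE -mulrnDl. Qed.

Lemma series_eulerM f g :
  series_euler (f * g) = series_euler f * g + f * series_euler g.
Proof.
apply/funext => n; rewrite series_addE !series_mulE -big_split /series_euler.
rewrite series_mulE -sumrMnl; apply: eq_bigr => i _.
have il := ltn_ord i; rewrite /= mulrnAl mulrnAr -mulrnDr subnKC //.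
Qed.

Lemma series_euler1 : series_euler 1 = 0.
Proof. by apply/funext => -[|n]; rewrite /series_euler ?mulr0n // series_oneE mul0rn. Qed.

Lemma series_eulerC c : series_euler (series_C c) = 0.
Proof. by apply/funext => -[|n]; rewrite /series_euler ?mulr0n //= mul0rn. Qed.

Lemma series_eulerX : series_euler series_X = series_X.
Proof.
by apply/funext => -[|[|n]]; rewrite /series_euler ?mulr0n //= ?mulr1n // mul0rn.
Qed.

End Series.

(** * Elimination between the generating functions *)

Section GeneratingFunction.
Context {S : comNzRingType} (y z : S).

Lemma tube_series_eq (B A : S) :
  (1 + z) * B = z * (A - 1) -> A = (1 + y * A) * (1 + B) ->
  (1 + B) + y * (1 + B) = 1 + (y * (1 + B) ^+ 2 + z * (y * (1 + B) ^+ 2)).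
Proof.
move=> BA AB; apply/subr0_eq.
(* This combination of the two hypotheses eliminates A. *)
have -> : 1 + B + y * (1 + B) - (1 + (y * (1 + B) ^+ 2 + z * (y * (1 + B) ^+ 2))) =
    (1 - y * (1 + B)) * ((1 + z) * B - z * (A - 1)) +
    z * (A - (1 + y * A) * (1 + B)) by ring.
by rewrite BA -AB !subrr !mulr0 addr0.
Qed.

(* With Q = 1 + B, i = 1 / Q and M = 2 - Q - y Q, the equation of Q says that    *)
(* (M i)^2 = (1 - y)^2 - 4 y z, and differentiating it gives t M = Q (Q - 1).   *)
Lemma cycle_series_eq (B t F s2 s1 o1 on oe : S) :
  (1 + B) + y * (1 + B) = 1 + (y * (1 + B) ^+ 2 + z * (y * (1 + B) ^+ 2)) ->
  t + (y * (1 + B) + y * t) = y * (1 + B) ^+ 2 + y * (2 * (1 + B) * t)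
     + z * (y * (1 + B) ^+ 2 + y * (2 * (1 + B) * t)) ->
  s2 = s1 + B * s1 -> s1 = 1 + y * s2 + B * s1 ->
  o1 = on + B * on -> on = 1 + y * o1 + B * oe -> oe = y * o1 + B * on ->
  F = 1 + y * s2 + 2 * (t * on) ->
  F * (1 - (2 + 4 * z) * y + y * y) = 1 - y - 2 * (y * z).
Proof.
set Q := 1 + B => EQ Et Es2 Es1 Eo1 Eon Eoe EF.
pose M := 2 - Q - y * Q.
(* Eliminating [o1] and [oe] multiplies [on] by 1 - B^2 - y Q^2, which is Q M. *)
have KQM : on * Q * M = 1.
  have e0 : on - (1 + y * (on + B * on) + B * (y * (on + B * on) + B * on)) = 0.
    by rewrite -Eo1 -Eoe -Eon subrr.
  by apply/subr0_eq; rewrite -[RHS]e0 /M /Q; ring.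
have s1M : s1 * M = 1.
  have e0 : s1 - (1 + y * (s1 + B * s1) + B * s1) = 0 by rewrite -Es2 -Es1 subrr.
  by apply/subr0_eq; rewrite -[RHS]e0 /M /Q; ring.
have s1E : s1 = Q * on.
  by rewrite -[LHS]mulr1 -KQM -[RHS]mulr1 -s1M; ring.
pose i := on * M; have iQ : i * Q = 1 by rewrite -KQM /i; ring.
have i2 : i * i = i * (1 + y) - y * (1 + z).
  have -> : i * (1 + y) = i * i * (Q + y * Q).
    by transitivity (i * Q * (i * (1 + y))); [rewrite iQ mul1r|ring].
  rewrite EQ; have -> : y * (1 + z) = (i * Q) ^+ 2 * (y * (1 + z)).
    by rewrite iQ expr1n mul1r.
  by ring.
have Mi : M * i = 2 * i - 1 - y.
  by transitivity (2 * i - i * Q - y * (i * Q)); [rewrite /M; ring|rewrite iQ mulr1].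
(* With e and e' the differences of the two sides of [EQ] and of its derivative [Et], the claim is a
   polynomial combination of e and e'. *)
have tM : t * M = Q * (Q - 1).
  apply/subr0_eq; have e1 := EQ; have e2 := Et.
  move/eqP: e1; rewrite -subr_eq0 => /eqP; set e := (X in X = 0) => e0.
  move/eqP: e2; rewrite -subr_eq0 => /eqP; set e' := (X in X = 0) => e'0.
  have -> : t * M - Q * (Q - 1) = Q * e' - Q * e - 2 * t * e.
    by rewrite /e /e' /M; ring.
  by rewrite e0 e'0; ring.
have D : 1 - (2 + 4 * z) * y + y * y = (M * i) * (M * i).
  have -> : M * i * (M * i) = 4 * (i * i) - 4 * i * (1 + y) + (1 + y) ^+ 2.
    by rewrite Mi; ring.
  by rewrite i2; ring.
have -> : F = 1 + y * (Q * Q * on) + 2 * (t * on).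
  by rewrite EF Es2 s1E /Q; ring.
have -> : (1 + y * (Q * Q * on) + 2 * (t * on)) * (1 - (2 + 4 * z) * y + y * y) =
    (M * i) * (M * i) + y * ((on * Q * M) * (i * Q) * (M * i)) +
    2 * (t * M * on * M * i * i).
  by rewrite D; ring.
have -> : t * M * on * M * i * i = i - i * i.
  rewrite tM; have -> : Q * (Q - 1) * on * M * i * i = on * Q * M * (i * Q * i - i * i) by ring.
  by rewrite KQM iQ; ring.
rewrite KQM iQ !mul1r Mi.
have -> : (2 * i - 1 - y) * (2 * i - 1 - y) + y * (2 * i - 1 - y) + 2 * (i - i * i) =
  2 * (i * i) - 2 * i * (1 + y) + 1 + y by ring.
by rewrite i2; ring.
Qed.

End GeneratingFunction.

(** * From the series to the face numbers *)

Definition cycle_poly (n : nat) : {poly int} := tubing_poly [set: vertex n]%SET.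

Lemma cycle_poly0 : cycle_poly 0 = 1.
Proof.
rewrite /cycle_poly -(tubing_poly0 (n := 0)); congr tubing_poly.
by apply/setP => -[[]].
Qed.

Lemma cycle_series_mul :
  (cycle_poly : series _) * (1 - series_C (2 + 4 * 'X) * series_X + series_X * series_X) =
  1 - series_X - 2 * (series_X * series_C 'X).
Proof.
pose y : series {poly int} := series_X.
pose B : series _ := tube_poly.
have Bmul (f : series _) m : (B * f) m = \sum_(l < m) tube_poly l.+1 * f (m - l.+1)%N.
  by apply: series_mulC0; apply: tube_poly0.
have C24 : series_C (2 + 4 * 'X) = 2 + 4 * series_C 'X :> series {poly int}.
  by rewrite series_CD series_CM !series_Cnat.
rewrite C24; set z : series {poly int} := series_C 'X.
have EQ : (1 + B) + y * (1 + B) = 1 + (y * (1 + B) ^+ 2 + z * (y * (1 + B) ^+ 2)).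
  apply: (@tube_series_eq _ _ _ _ (arc_poly : series _)); apply/funext => n.
    rewrite mulrDl mul1r series_addE !series_CE series_addE series_oppE series_oneE.
    case: n => [|n]; last by rewrite subr0 -tube_poly_arc // mulrDl mul1r.
    by rewrite /B tube_poly0 /arc_poly seg_empty // tubing_poly0 subrr !mulr0 addr0.
  rewrite mulrDr mulr1 series_addE [_ * B]mulrC Bmul series_addE series_XE series_oneE.
  case: n => [|n].
    by rewrite big_ord0 !addr0 /arc_poly seg_empty // tubing_poly0.
  rewrite add0r arc_poly_rec; congr (_ + _); apply: eq_bigr => i _.
  rewrite subSS series_addE series_XE series_oneE.
  by case: (n - i)%N => [|j]; rewrite ?addr0 ?add0r.
have Et := congr1 (@series_euler _) EQ.
pose t := series_euler B.
have tmul (f : series _) m :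
    (t * f) m = \sum_(l < m) (tube_poly l.+1 *+ l.+1) * f (m - l.+1)%N.
  by apply: series_mulC0.
apply: (@cycle_series_eq _ y z B t _ (strip2 : series _) (strip1 : series _)
  (open1 : series _) (open_ne : series _) (open_eq : series _)) => //.
- move: Et; rewrite expr2 !(series_eulerD, series_eulerM) series_euler1 series_eulerC series_eulerX.
  by rewrite -/t -/y !add0r mul0r add0r => ->; ring.
- by apply/funext => n; rewrite series_addE Bmul strip2_rec.
- apply/funext => -[|n]; rewrite !series_addE Bmul series_XE series_oneE.
    by rewrite strip1_0 big_ord0 !addr0.
  by rewrite strip1_rec add0r.
- by apply/funext => n; rewrite series_addE Bmul open1_rec.
- apply/funext => -[|n]; rewrite !series_addE Bmul series_XE series_oneE.
    by rewrite open_ne0 big_ord0 !addr0.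
  by rewrite open_ne_rec add0r.
- apply/funext => -[|n]; rewrite !series_addE Bmul series_XE.
    by rewrite big_ord0 addr0.
  by rewrite open_eq_rec.
- apply/funext => -[|n]; rewrite !series_addE mulr_natl mulr2n series_addE tmul series_XE series_oneE.
    by rewrite big_ord0 cycle_poly0 !addr0.
  rewrite add0r /cycle_poly cycle_rec mulr2n; congr (_ + _).
  by congr (_ + _); apply: eq_bigr => l _; rewrite mulrnAl.
Qed.

Lemma cycle_poly_coef n :
  cycle_poly n - (2 + 4 * 'X) * (if n is k.+1 then cycle_poly k else 0) +
    (if n is k.+2 then cycle_poly k else 0) =
  (n == 0%N)%:R - (1 + 2 * 'X) * (n == 1%N)%:R.
Proof.
pose F : series {poly int} := cycle_poly; pose y : series {poly int} := series_X.
have E : F - series_C (2 + 4 * 'X) * (y * F) + y * (y * F) =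
    1 - series_C (1 + 2 * 'X) * y.
  rewrite [series_C (1 + _)]series_CD [series_C (2 * _)]series_CM.
  rewrite (series_Cnat 1) (series_Cnat 2).
  have := cycle_series_mul; rewrite -/F -/y => H.
  transitivity (F * (1 - series_C (2 + 4 * 'X) * y + y * y)); first by ring.
  by rewrite H; ring.
have := congr1 (fun f : series {poly int} => f n) E.
by case: n => [|[|n]];
  rewrite !(series_addE, series_oppE, series_CE, series_XE, series_oneE).
Qed.

Lemma cycle_poly1 : cycle_poly 1 = 1 + 2 * 'X.
Proof.
have /eqP := cycle_poly_coef 1; rewrite cycle_poly0 /= addr0 mulr1 sub0r mulr1.
by rewrite subr_eq => /eqP ->; ring.
Qed.

Lemma cycle_poly_rec n :
  cycle_poly n.+2 = (2 + 4 * 'X) * cycle_poly n.+1 - cycle_poly n.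
Proof.
have /eqP := cycle_poly_coef n.+2; rewrite /= mulr0 subr0 addr_eq0 subr_eq => /eqP ->.
by ring.
Qed.

Lemma coef_cycle_poly_gt n t : (n < t)%N -> (cycle_poly n)`_t = 0.
Proof.
move=> nt; suff /leq_sizeP : (size (cycle_poly n) <= n.+1)%N by apply.
suff [] : (size (cycle_poly n) <= n.+1)%N /\ (size (cycle_poly n.+1) <= n.+2)%N by [].
elim: n {nt} => [|n [IH1 IH2]].
  rewrite cycle_poly0 cycle_poly1 size_poly1; split=> //.
  apply/leq_sizeP => -[|[|j]] // _.
  by rewrite coefD coef1 mulr_natl coefMn coefX.
split=> //; rewrite cycle_poly_rec; apply/leq_sizeP => -[|[|[|j]]] // nj.
rewrite coefB mulrDl -mulrA !mulr_natl coefD !coefMn coefXM /=.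
have /leq_sizeP -> // := IH1; last by lia.
have /leq_sizeP H := IH2; rewrite !H ?mul0rn ?subr0 ?addr0 //; lia.
Qed.

(* The reversal comes from faces of dimension k being tubings with n - k tubes. *)
Definition face_poly (n : nat) : {poly int} := \poly_(k < n.+1) (cycle_poly n)`_(n - k).

(** From here on 'X marks dimension instead of tubes. Reversal sends 2 + 4 'X to 2 'X + 4 and the
    coefficient 1 to 'X^2; the boundary terms vanish because [cycle_poly n] has degree at most n. *)
Lemma face_poly_rec n :
  face_poly n.+2 = (2 * 'X + 4) * face_poly n.+1 - 'X ^+ 2 * face_poly n.
Proof.
apply/polyP => k; rewrite coefB mulrDl -mulrA !mulr_natl coefD !coefMn coefXM coefXnM.
rewrite !coef_poly cycle_poly_rec mulrDl -mulrA !mulr_natl coefB coefD !coefMn coefXM.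
case: k => [|[|k]] /=.
- by rewrite !subn0 (coef_cycle_poly_gt (ltnSn n.+1)) (@coef_cycle_poly_gt n n.+2) // !mul0rn.
- by rewrite !subSS !subn0 (coef_cycle_poly_gt (ltnSn n)).
rewrite !subSS !ltnS subn0; have [k_n|n_k|->] := ltngtP k n.
- by rewrite subnS; case E : (n - k)%N => [|j] //; lia.
- by rewrite !mul0rn !add0r oppr0.
- by rewrite subnn !mul0rn.
Qed.

(** The coefficient of y^n in the inverse of (1 - x y)^2 - 4 y = 1 - (2 x + 4) y + x^2 y^2. *)
Fixpoint denom_inv (n : nat) : {poly int} :=
  if n is n1.+1 then
    if n1 is n2.+1 then (2 * 'X + 4) * denom_inv n1 - 'X ^+ 2 * denom_inv n2
    else 2 * 'X + 4
  else 1.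

Lemma denom_invSS n :
  denom_inv n.+2 = (2 * 'X + 4) * denom_inv n.+1 - 'X ^+ 2 * denom_inv n.
Proof. by []. Qed.

(** The sequences satisfy the same recurrence of order two, so two initial values suffice; 1 - (x +
    2) y is the numerator of the fraction. *)
Lemma face_poly_denom_inv n : face_poly n =
  denom_inv n - ('X + 2) * (if n is k.+1 then denom_inv k else 0).
Proof.
suff [] : face_poly n = denom_inv n - ('X + 2) * (if n is k.+1 then denom_inv k else 0) /\
    face_poly n.+1 = denom_inv n.+1 - ('X + 2) * denom_inv n by [].
elim: n => [|n [IH1 IH2]].
  split; apply/polyP => k.
    by rewrite /face_poly coef_poly cycle_poly0 mulr0 subr0 !coef1; case: k.
  have -> : denom_inv 1 - ('X + 2) * denom_inv 0 = 'X + 2 by rewrite /=; ring.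
  rewrite /face_poly coef_poly cycle_poly1 mulr_natl.
  by case: k => [|[|k]]; rewrite /= !(coefD, coefMn, coefX, coef1).
split=> //; rewrite face_poly_rec IH1 IH2.
case: n {IH1 IH2} => [|n]; first by rewrite /=; ring.
by rewrite !denom_invSS; ring.
Qed.

Lemma bps_mul_poly (s : seq {poly int}) (E : nat -> {poly int}) n k :
  bps_mul (bps_of_poly (Poly s)) (fun n k => (E n)`_k) n k =
  (\sum_(i < n.+1) s`_i * E (n - i)%N)`_k.
Proof.
rewrite /bps_mul coef_sum; apply: eq_bigr => i _.
by rewrite coefM; apply: eq_bigr => j _; rewrite /bps_of_poly coef_Poly.
Qed.

Theorem proposition6p1p29 (R : realType) (m : nat -> nat)
    (P : forall n : nat, set 'rV[R]_(m n))
    (hP : forall n : nat, twisted_cycle_associahedron n (P n)) :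
  bps_eq_frac (f_polynomial P)
    ((1 - px * py) - 2%:R * py)
    ((1 - px * py) ^+ 2 - 4%:R * py).
Proof.
have -> : (1 - px * py) - 2%:R * py = Poly [:: 1; - ('X + 2)].
  rewrite /= !cons_poly_def /px /py polyCN polyCD polyC1 mul0r add0r.
  by rewrite (rmorph_nat polyC 2); ring.
have -> : (1 - px * py) ^+ 2 - 4%:R * py = Poly [:: 1; - (2 * 'X + 4); 'X ^+ 2].
  rewrite /= !cons_poly_def /px /py polyC_exp polyCN polyCD polyCM polyC1 mul0r add0r.
  by rewrite (rmorph_nat polyC 2) (rmorph_nat polyC 4) /=; ring.
(* Multiplied by the denominator this gives 1, by the recurrence of [denom_inv]; multiplied by the
   numerator it gives [face_poly]. *)
exists (fun n k => (denom_inv n)`_k); split=> n k; rewrite bps_mul_poly.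
  rewrite /bps_of_poly coef1; case: n => [|[|n]].
  - by rewrite big_ord1 mul1r.
  - by rewrite big_ord_recl big_ord1 /= !mul1r mulr1 subrr.
  - rewrite !big_ord_recl big1 => [|i _]; last by rewrite /= nth_nil mul0r.
    set s := (X in polyseq X); suff -> : s = 0 by [].
    by rewrite /s /bump /= !subSS subn0; ring.
have -> : \sum_(i < n.+1) [:: 1; - ('X + 2)]`_i * denom_inv (n - i)%N = face_poly n.
  rewrite face_poly_denom_inv; case: n => [|n]; first by rewrite big_ord1 /=; ring.
  rewrite !big_ord_recl big1 => [|i _]; last by rewrite /= nth_nil mul0r.
  by rewrite /= subSS subn0; ring.
rewrite /f_polynomial (nfaces_tubings k (hP n)) /face_poly coef_poly ltnS.
by case: ifP => // _; rewrite /cycle_poly coef_tubing_poly.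
Qed.
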